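(* Let $\Omega\subset\mathbb{R}^d$ be a compact set with Lipschitz boundary satisfying an interior cone condition. Let $\Psi,\Phi$ be correlation functions on $\mathbb{R}^d$ with spectral densities $f_\Psi,f_\Phi$ such that, for some constants $c_2\ge c_1>0$, $c_4\ge c_3>0$ and $\nu_0,\nu>0$, for all $\omega\in\mathbb{R}^d$, $$c_1(1+\|\omega\|^2)^{-(\nu_0+d/2)}\le f_\Psi(\omega)\le c_2(1+\|\omega\|^2)^{-(\nu_0+d/2)},\qquad c_3(1+\|\omega\|^2)^{-(\nu+d/2)}\le f_\Phi(\omega)\le c_4(1+\|\omega\|^2)^{-(\nu+d/2)}.$$ Let $Z$ be a stationary Gaussian process on $\mathbb{R}^d$ with mean zero and covariance $\mathrm{Cov}(Z(x),Z(x'))=\sigma^2\Psi(x-x')$, $\sigma^2>0$, and let $1\le p<\infty$. Suppose $\nu\le\nu_0$. Then there exist constants $C_1,C_2>0$ and $h_0\in(0,1]$, such that for any design $X\subset\Omega$ with $h_{X,\Omega}\le h_0$ and any $t>0$, with probability at least $1-\exp\{-t^2/(C_1\sigma^2h_{X,\Omega}^{2\nu})\}$, $$\|Z-\mathcal{I}_{\Phi,X}Z\|_{L_p(\Omega)}\le C_2\,\sigma\, h_{X,\Omega}^{\nu}+t.$$ The constants $C_1,C_2$ depend only on $\Omega,p,\Phi$ and $\Psi$ (including $\nu$ and $\nu_0$).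
   Context: A correlation function is a continuous, integrable, symmetric, positive definite function $\Psi$ on $\mathbb{R}^d$ (i.e. $(x,x')\mapsto\Psi(x-x')$ is a positive definite kernel) with $\Psi(0)=1$; its spectral density $f_\Psi$ is the function with $\Psi(x)=\int_{\mathbb{R}^d}e^{i\omega^Tx}f_\Psi(\omega)\,d\omega$. $\|\cdot\|$ is the Euclidean norm. The Gaussian process $Z$ is taken with almost surely continuous sample paths. A set $\Omega$ satisfies an interior cone condition if there exist an angle $\alpha\in(0,\pi/2)$ and a radius $R>0$ such that for every $x\in\Omega$ there is a unit vector $\xi(x)$ such that the cone $\{x+\lambda y:y\in\mathbb{R}^d,\|y\|=1,y^T\xi(x)\ge\cos\alpha,\lambda\in[0,R]\}$ is contained in $\Omega$. A design is a finite set $X=\{x_1,\ldots,x_n\}\subset\Omega$ of distinct points. Fill distance: $h_{X,\Omega}=\sup_{x\in\Omega}\inf_{x_j\in X}\|x-x_j\|$. The kriging interpolant with imposed correlation $\Phi$ is $\mathcal{I}_{\Phi,X}Z(x)=r_\Phi^T(x)K_\Phi^{-1}Y$, where $r_\Phi(x)=(\Phi(x-x_1),\ldots,\Phi(x-x_n))^T$, $K_\Phi=(\Phi(x_j-x_k))_{jk}$ and $Y=(Z(x_1),\ldots,Z(x_n))^T$. The norm is $\|g\|_{L_p(\Omega)}=(\int_\Omega|g(x)|^p\,dx)^{1/p}$. *)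

(* Defs.v *)
From HB Require Import structures.
From mathcomp Require Import all_boot all_order all_algebra.
From mathcomp Require Import all_classical all_reals all_analysis.
Set Implicit Arguments.
Unset Strict Implicit.
Unset Printing Implicit Defensive.
Import Order.TTheory GRing.Theory Num.Theory.
Import numFieldNormedType.Exports.
Local Open Scope classical_set_scope.
Local Open Scope ring_scope.

(* The sigma-algebra generated by the coordinates, as the library does for
   n.-tuple; it is the Borel sigma-algebra of 'rV[R]_n. *)
Definition rV_display : measure_display.
Proof. exact. Qed.

Section measurable_rV.
Variables (R : realType) (n : nat).

Definition rV_coord : 'I_n -> 'rV[R]_n -> R := fun i x => x ord0 i.

Let rV_set0 : g_sigma_preimage rV_coord set0.
Proof. exact: sigma_algebra0. Qed.

Let rV_setC A : g_sigma_preimage rV_coord A -> g_sigma_preimage rV_coord (~` A).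
Proof. exact: sigma_algebraC. Qed.

Let rV_bigcup (F : (set 'rV[R]_n)^nat) :
  (forall i, g_sigma_preimage rV_coord (F i)) ->
  g_sigma_preimage rV_coord (\bigcup_i (F i)).
Proof. exact: sigma_algebra_bigcup. Qed.

HB.instance Definition _ := @isMeasurable.Build rV_display
  'rV[R]_n (g_sigma_preimage rV_coord) rV_set0 rV_setC rV_bigcup.

End measurable_rV.

Lemma measurable_rV_coord (R : realType) n (i : 'I_n) :
  measurable_fun [set: 'rV[R]_n] (fun x : 'rV[R]_n => x ord0 i).
Proof.
move=> _ Y mY; rewrite setTI; apply: sub_sigma_algebra => /=.
rewrite -bigcup_seq/=; exists i => /=; first by rewrite mem_index_enum.
by exists Y => //; rewrite setTI.
Qed.

Lemma measurable_fun_rVP d (T : measurableType d) (R : realType) n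
    (f : T -> 'rV[R]_n) :
  measurable_fun [set: T] f <->
  forall i, measurable_fun [set: T] (fun x => f x ord0 i).
Proof.
split=> [mf i|mf].
  exact: (measurableT_comp (measurable_rV_coord i) mf).
apply: (@iffRL _ (g_sigma_preimage
    (fun i => @rV_coord R n i \o f) `<=` measurable)).
  rewrite g_sigma_preimage_comp; split=> [mf' A [/= C preC <-]|prefS].
    exact: mf'.
  by move=> _ A mA; apply: prefS; exists A.
apply: smallest_sub; first exact: sigma_algebra_measurable.
case: n => [|n] in f mf *; first by rewrite big_ord0.
rewrite -bigcup_mkord_ord; apply: bigcup_sub => i Ii.
by move=> A [B mB <-]; exact: mf.
Qed.

Section lebesgue_rV.
Variable R : realType.

Definition cons_rV n (p : measurableTypeR R * 'rV[R]_n) : 'rV[R]_n.+1 :=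
  row_mx (const_mx p.1 : 'rV[R]_1) p.2.

Lemma cons_rV0 n (p : measurableTypeR R * 'rV[R]_n) :
  cons_rV p ord0 ord0 = p.1.
Proof.
have := row_mxEl (const_mx p.1 : 'rV[R]_1) p.2 ord0 ord0; rewrite [RHS]mxE => <-.
by congr (row_mx _ _ _ _); exact/val_inj.
Qed.

Lemma cons_rVS n (p : measurableTypeR R * 'rV[R]_n) (j : 'I_n) :
  cons_rV p ord0 (lift ord0 j) = p.2 ord0 j.
Proof.
have <- := row_mxEr (const_mx p.1 : 'rV[R]_1) p.2 ord0 j.
by congr (row_mx _ _ _ _); exact/val_inj.
Qed.

Lemma measurable_cons_rV n : measurable_fun setT (@cons_rV n).
Proof.
apply/measurable_fun_rVP => i; have [->|i0] := eqVneq i ord0.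
  apply: (eq_measurable_fun fst) => //.
    by move=> p _; rewrite cons_rV0.
have [j ->] : exists j, i = lift ord0 j.
  by case: (unliftP ord0 i) i0 => [j ->|->]; [exists j|rewrite eqxx].
apply: (eq_measurable_fun ((fun x : 'rV[R]_n => x ord0 j) \o snd)).
  by move=> p _; rewrite cons_rVS.
by apply: measurableT_comp => //; exact: measurable_rV_coord.
Qed.

Definition uncons_rV n (x : 'rV[R]_n.+1) : measurableTypeR R * 'rV[R]_n :=
  (x ord0 ord0, \row_j x ord0 (lift ord0 j)).

Lemma cons_rVK n : cancel (@cons_rV n) (@uncons_rV n).
Proof.
move=> [a x]; rewrite /uncons_rV cons_rV0; congr pair.
by apply/rowP => j; rewrite mxE cons_rVS.
Qed.

Lemma measurable_uncons_rV n : measurable_fun setT (@uncons_rV n).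
Proof.
apply/measurable_fun_pair; first exact: (measurable_rV_coord ord0).
apply/measurable_fun_rVP => j.
apply: (eq_measurable_fun (fun x : 'rV[R]_n.+1 => x ord0 (lift ord0 j))).
  by move=> x _; rewrite mxE.
exact: measurable_rV_coord.
Qed.

Section succ.
Variables (n : nat) (m : {sigma_finite_measure set 'rV[R]_n -> \bar R}).

Definition lebesgue_rV_succ : set 'rV[R]_n.+1 -> \bar R :=
  pushforward (lebesgue_measure \x m)%E (@cons_rV n).

Let lebesgue_rV_succ0 : lebesgue_rV_succ set0 = 0%E.
Proof. by rewrite /lebesgue_rV_succ /pushforward preimage_set0 measure0. Qed.

Let lebesgue_rV_succ_ge0 A : (0 <= lebesgue_rV_succ A)%E.
Proof.
rewrite /lebesgue_rV_succ /pushforward.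
exact: (measure_ge0 (lebesgue_measure \x m)%E).
Qed.

Let lebesgue_rV_succ_sigma_additive : semi_sigma_additive lebesgue_rV_succ.
Proof.
move=> F mF tF mUF; rewrite /lebesgue_rV_succ /pushforward preimage_bigcup.
apply: measure_semi_sigma_additive.
- by move=> k; rewrite -[X in measurable X]setTI; exact: measurable_cons_rV.
- apply/trivIsetP => /= i j _ _ ij; rewrite -preimage_setI.
  by move/trivIsetP : tF => /(_ _ _ _ _ ij) ->//; rewrite preimage_set0.
- rewrite -preimage_bigcup -[X in measurable X]setTI.
  exact: measurable_cons_rV.
Qed.

HB.instance Definition _ := isMeasure.Build _ _ _ lebesgue_rV_succ
  lebesgue_rV_succ0 lebesgue_rV_succ_ge0 lebesgue_rV_succ_sigma_additive.

Let lebesgue_rV_succ_sigma_finite : sigma_finite setT lebesgue_rV_succ.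
Proof.
have /sigma_finiteP[F [TF ndF Foo]] :=
  @sigma_finiteT _ _ _ (@lebesgue_measure R).
have /sigma_finiteP[G [TG ndG Goo]] := sigma_finiteT m.
exists (fun k => @uncons_rV n @^-1` (F k `*` G k)).
  rewrite -preimage_bigcup (_ : \bigcup_i _ = setT) ?preimage_setT//.
  rewrite -setXTT TF TG predeqE => -[x y]; split.
    by move=> [k _ []/= ? ?]; split; exists k.
  move=> [/= [k _ Fkx] [l _ Gly]]; exists (maxn k l) => //; split.
  - by move: x Fkx; exact/subsetPset/ndF/leq_maxl.
  - by move: y Gly; exact/subsetPset/ndG/leq_maxr.
move=> k; have [mF Fk] := Foo k; have [mG Gk] := Goo k; split.
  rewrite -[X in measurable X]setTI; apply: measurable_uncons_rV => //.
  exact: measurableX.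
rewrite /lebesgue_rV_succ /pushforward -comp_preimage.
rewrite (_ : _ \o _ = id) ?preimage_id; last by apply/funext; exact: cons_rVK.
by rewrite product_measure1E// lte_mul_pinfty// ge0_fin_numE.
Qed.

HB.instance Definition _ := Measure_isSigmaFinite.Build _ _ _
  lebesgue_rV_succ lebesgue_rV_succ_sigma_finite.

End succ.

(* Lebesgue measure on R^n: the image of the n-fold product of
   lebesgue_measure under the identification R x R^n = R^(n+1). *)
Fixpoint lebesgue_rV n : {sigma_finite_measure set 'rV[R]_n -> \bar R} :=
  if n is n'.+1 then lebesgue_rV_succ (lebesgue_rV n')
  else \d_(0 : 'rV[R]_0).

End lebesgue_rV.
Arguments lebesgue_rV {R n}.

(* The library norm `|x| on 'rV[R]_d is the sup norm (with the usual topology),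
   hence the separate Euclidean structure. *)
Definition dotp (R : realType) (d : nat) (x y : 'rV[R]_d) : R :=
  \sum_(i < d) x ord0 i * y ord0 i.

Definition enorm (R : realType) (d : nat) (x : 'rV[R]_d) : R :=
  Num.sqrt (dotp x x).

Definition interior_cone_condition (R : realType) (d : nat)
    (Omega : set 'rV[R]_d) : Prop :=
  exists alpha r : R, [/\ 0 < alpha, alpha < pi / 2, 0 < r &
    forall x, Omega x -> exists xi : 'rV[R]_d, enorm xi = 1 /\
      forall (y : 'rV[R]_d) (l : R),
        enorm y = 1 -> cos alpha <= dotp y xi -> 0 <= l <= r ->
        Omega (x + l *: y)].

(* Near each boundary point, after a rigid motion, Omega is the closed
   epigraph of a Lipschitz function.  The unit vector e is the vertical axis
   and g is only evaluated on the horizontal hyperplane orthogonal to e. *)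
Definition lipschitz_boundary (R : realType) (d : nat)
    (Omega : set 'rV[R]_d) : Prop :=
  forall x0, (closure Omega `\` interior Omega) x0 ->
    exists (r L : R) (e : 'rV[R]_d) (g : 'rV[R]_d -> R),
      [/\ 0 < r, enorm e = 1,
          forall y z, `|g y - g z| <= L * enorm (y - z) &
          forall y, enorm (y - x0) < r ->
            (Omega y <-> g (y - dotp y e *: e) <= dotp y e)].

(* Strict positive definiteness, so that the matrices K_Phi are invertible. *)
Definition positive_definite_kernel (R : realType) (E : Type)
    (K : E -> E -> R) : Prop :=
  forall (n : nat) (x : 'I_n -> E) (a : 'I_n -> R),
    injective x -> (exists i, a i != 0) ->
    0 < \sum_(i < n) \sum_(j < n) a i * a j * K (x i) (x j).

Definition correlation_function (R : realType) (d : nat)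
    (Psi : 'rV[R]_d -> R) : Prop :=
  [/\ continuous Psi,
      lebesgue_rV.-integrable setT (EFin \o Psi),
      forall x, Psi (- x) = Psi x,
      positive_definite_kernel (fun x y => Psi (x - y)) &
      Psi 0 = 1].

(* Psi(x) = int exp(i w.x) f(w) dw, split into real and imaginary parts. *)
Definition spectral_density (R : realType) (d : nat)
    (Psi f : 'rV[R]_d -> R) : Prop :=
  lebesgue_rV.-integrable setT (EFin \o f) /\
  forall x,
    (\int[lebesgue_rV]_w (cos (dotp w x) * f w)%:E = (Psi x)%:E /\
     \int[lebesgue_rV]_w (sin (dotp w x) * f w)%:E = 0)%E.

Section gaussian_process.
Context {dT : measure_display} {T : measurableType dT} {R : realType}.
Variable P : probability T R.

(* A point mass is a (degenerate) normal law; the library's normal_prob m 0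
   is not a point mass. *)
Definition normal_rv (X : T -> R) : Prop :=
  exists m s : R, 0 <= s /\ forall A : set R, measurable A ->
    P (X @^-1` A) = if s == 0 then \d_m A else normal_prob m s A.

(* All finite-dimensional distributions are (possibly degenerate) multivariate
   normal, i.e. all finite linear combinations are normal. *)
Definition gaussian_process (I : Type) (Z : I -> {RV P >-> R}) : Prop :=
  forall (n : nat) (x : 'I_n -> I) (a : 'I_n -> R),
    normal_rv (fun w => \sum_(i < n) a i * Z (x i) w).

(* The event B contains a measurable event of probability at least q; for
   measurable B this is q <= P B. *)
Definition with_probability_at_least (q : R) (B : set T) : Prop :=
  exists A : set T, [/\ measurable A, A `<=` B & (q%:E <= P A)%E].

End gaussian_process.

Definition design (R : realType) (d n : nat) (Omega : set 'rV[R]_d)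
    (X : 'I_n -> 'rV[R]_d) : Prop :=
  [/\ (0 < n)%N, injective X & forall i, Omega (X i)].

Definition fill_distance (R : realType) (d n : nat) (X : 'I_n -> 'rV[R]_d)
    (Omega : set 'rV[R]_d) : R :=
  sup [set inf [set enorm (x - X j) | j in [set: 'I_n]] | x in Omega].

Definition kriging (R : realType) (d n : nat) (Phi : 'rV[R]_d -> R)
    (X : 'I_n -> 'rV[R]_d) (z : 'rV[R]_d -> R) (x : 'rV[R]_d) : R :=
  let r : 'cV[R]_n := \col_j Phi (x - X j) in
  let K : 'M[R]_n := \matrix_(j, k) Phi (X j - X k) in
  let Y : 'cV[R]_n := \col_j z (X j) in
  (r^T *m invmx K *m Y) ord0 ord0.

Definition Lp_norm (R : realType) (d : nat) (p : R) (Omega : set 'rV[R]_d)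
    (g : 'rV[R]_d -> R) : \bar R :=
  Lnorm lebesgue_rV p%:E ((EFin \o g) \_ Omega).

(* Main.v *)
Require Import Defs.
From mathcomp Require Import all_boot all_order all_algebra.
From mathcomp Require Import all_classical all_reals all_analysis.
From mathcomp Require Import measurable_realfun ring lra.
Import Order.TTheory GRing.Theory Num.Theory.
Import numFieldNormedType.Exports.
Local Open Scope classical_set_scope.
Local Open Scope ring_scope.
Set Implicit Arguments.
Unset Strict Implicit.
Unset Printing Implicit Defensive.

(** The error [G x = Z x - sum_j k_j (x) Z (X j)] of kriging is, at each point,
    a centred Gaussian variable, so the proof bounds its variance uniformly over
    [Omega] and then passes from points to the [L_p] norm.

    Variance.  For weights [a], the variance of [Z x - sum_j a_j Z (X j)] is
    [sigma^2] times a quadratic form in [Psi] ([second_moment_combination]),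
    which equals the integral of
    [`|exp (i w.x) - sum_j a_j exp (i w.X_j)|^2] against the spectral density
    ([spectral_quadratic_form]).  As [nu <= nu0], the density of [Psi] is at most
    a constant times that of [Phi], so the form in [Psi] is at most the same
    constant times the form in [Phi] ([err_form_le]).  The kriging weights
    minimise the form in [Phi] ([kriging_weight_optimal]); hence any other
    weights give an upper bound.  The cone condition provides, at scale the fill
    distance [h], boundedly many design points that lie close to an affine copy
    of the integer grid, and perturbed Lagrange interpolation yields weights with
    bounded absolute sum that reproduce polynomials of degree less than [m]
    ([local_polynomial_reproduction]).  By Taylor expansion the integrand is then
    at most a constant times [min 1 (h `|w|)^(2 m)] ([exp_sum_error]), and for
    [m > nu] its integral against [(1 + `|w|^2)^(- nu - d/2)] is at most a
    constant times [h^(2 nu)] ([decay_integral_le]).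

    Norm.  Let [v], of order [sigma^2 h^(2 nu)], bound the variance.  Then
    [exp (G x ^ 2 / (20 v))] has expectation at most [2] for every [x]
    ([normal_rv_exp_moment]), hence so does its average over [Omega], and the
    Markov inequality makes this average smaller than [exp (mu^2 / (20 v))]
    outside an event of probability at most [2 exp (- mu^2 / (20 v))].  On the
    complement, comparing [`|y|^p] with [exp (y^2 / (20 v))] bounds the [L_p] norm
    by a multiple of [mu] ([integral_powR_tail]).  With [mu] proportional to
    [C2 sigma h^nu + t], the part [C2 sigma h^nu] absorbs the factor [2].

    Sample paths are continuous outside a null set, and off this set the error is
    a function of [(x, w)] that is continuous in [x] and measurable in [w], hence
    jointly measurable ([caratheodory_measurable]); this justifies exchanging the
    expectation with the integral over [Omega]. *)

(** * Euclidean geometry and the cone condition *)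

Section euclidean.
Variables (R : realType) (d : nat).
Implicit Types x y z : 'rV[R]_d.

Lemma dotpC x y : dotp x y = dotp y x.
Proof. by apply: eq_bigr => i _; rewrite mulrC. Qed.

Lemma dotpDl x y z : dotp (x + y) z = dotp x z + dotp y z.
Proof.
by rewrite /dotp -big_split; apply: eq_bigr => i _; rewrite mxE mulrDl.
Qed.

Lemma dotpDr x y z : dotp z (x + y) = dotp z x + dotp z y.
Proof. by rewrite dotpC dotpDl !(dotpC z). Qed.

Lemma dotpZl (a : R) x z : dotp (a *: x) z = a * dotp x z.
Proof.
by rewrite /dotp mulr_sumr; apply: eq_bigr => i _; rewrite mxE mulrA.
Qed.

Lemma dotpZr (a : R) x z : dotp z (a *: x) = a * dotp z x.
Proof. by rewrite dotpC dotpZl dotpC. Qed.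

Lemma dotpNr x z : dotp z (- x) = - dotp z x.
Proof. by rewrite -scaleN1r dotpZr mulN1r. Qed.

Lemma dotpBr x y z : dotp z (x - y) = dotp z x - dotp z y.
Proof. by rewrite dotpDr dotpNr. Qed.

Lemma dotp_ge0 x : 0 <= dotp x x.
Proof. by apply: sumr_ge0 => i _; rewrite -expr2 sqr_ge0. Qed.

Lemma enorm_ge0 x : 0 <= enorm x.
Proof. exact: sqrtr_ge0. Qed.

Lemma enorm_sqr x : enorm x ^+ 2 = dotp x x.
Proof. by rewrite sqr_sqrtr// dotp_ge0. Qed.

Lemma enormZ (a : R) x : enorm (a *: x) = `|a| * enorm x.
Proof.
by rewrite /enorm dotpZl dotpZr mulrA sqrtrM -?expr2 ?sqr_ge0// sqrtr_sqr.
Qed.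

Lemma enormN x : enorm (- x) = enorm x.
Proof. by rewrite -scaleN1r enormZ normrN1 mul1r. Qed.

Lemma enorm_coord x i : `|x ord0 i| <= enorm x.
Proof.
rewrite -sqrtr_sqr ler_sqrt ?dotp_ge0// /dotp (bigD1 i)//= expr2 lerDl.
by apply: sumr_ge0 => j _; rewrite -expr2 sqr_ge0.
Qed.

Lemma enorm_le_coord x (B : R) : 0 <= B -> (forall i, `|x ord0 i| <= B) ->
  enorm x <= d%:R * B.
Proof.
move=> B0 xB; rewrite -ler_sqr ?nnegrE ?enorm_ge0 ?mulr_ge0//.
rewrite enorm_sqr; apply: (@le_trans _ _ (\sum_(i < d) B ^+ 2)).
  apply: ler_sum => i _; rewrite -expr2 -real_normK ?num_real//.
  by rewrite ler_sqr ?nnegrE.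
rewrite sumr_const card_ord -[leLHS]mulr_natl exprMn ler_wpM2r ?sqr_ge0//.
by rewrite -natrX ler_nat; case: d => // k; rewrite leq_pmulr.
Qed.

Lemma cauchy_schwarz x y : `|dotp x y| <= enorm x * enorm y.
Proof.
rewrite -ler_sqr ?nnegrE ?mulr_ge0 ?enorm_ge0// exprMn !enorm_sqr.
rewrite real_normK ?num_real//.
have [y0|y0] := eqVneq (dotp y y) 0.
  suff -> : dotp x y = 0 by rewrite expr0n/= mulr_ge0 ?dotp_ge0.
  apply: big1 => i _; have := enorm_coord y i.
  by rewrite /enorm y0 sqrtr0 normr_le0 => /eqP ->; rewrite mulr0.
have yp : 0 < dotp y y by rewrite lt_neqAle eq_sym y0 dotp_ge0.
have := dotp_ge0 (dotp y y *: x - dotp x y *: y).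
rewrite -scaleNr !(dotpDl, dotpDr, dotpZl, dotpZr) (dotpC y x) => H.
rewrite -subr_ge0 -(pmulr_rge0 _ yp); apply: le_trans H _.
by rewrite le_eqVlt; apply/orP; left; apply/eqP; ring.
Qed.

Lemma enormD x y : enorm (x + y) <= enorm x + enorm y.
Proof.
rewrite -ler_sqr ?nnegrE ?addr_ge0 ?enorm_ge0// sqrrD !enorm_sqr.
rewrite dotpDl !dotpDr (dotpC y x) -addrA -[leRHS]addrA lerD2l addrA lerD2r.
rewrite -mulr2n lerMn2r/=.
exact: le_trans (ler_norm _) (cauchy_schwarz x y).
Qed.

End euclidean.

(** The cone at [x] contains a ball of radius proportional to the distance of
    its centre from [x]: for [|eta| <= kappa] the angle between [xi + eta] and
    [xi] has cosine at least [(1 - kappa) / (1 + kappa)], and [kappa] is chosen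
    to make this equal to [cos alpha]. *)
Lemma cone_contains_ball (R : realType) (d : nat) (Omega : set 'rV[R]_d) :
  interior_cone_condition Omega ->
  exists kappa r : R, [/\ 0 < kappa, 0 < r &
    forall x, Omega x -> exists2 xi : 'rV[R]_d, enorm xi = 1 &
      forall (eta : 'rV[R]_d) rho, enorm eta <= kappa -> 0 <= rho <= r ->
        Omega (x + rho *: (xi + eta))].
Proof.
move=> [alpha [r [alpha0 alphapi r0 cone]]].
have c1 : cos alpha < 1.
  rewrite -(@cos0 R) ltr_cos// in_itv/= ?lexx ?pi_ge0// (ltW alpha0)/=.
  apply/ltW/(lt_le_trans alphapi); have := pi_ge0 R; lra.
have c0 : 0 < cos alpha by apply: cos_gt0_pihalf; apply/andP; split; lra.
set c := cos alpha in c0 c1 cone.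
pose kappa := (1 - c) / (1 + c).
have kE : kappa * (1 + c) = 1 - c by rewrite /kappa; field; lra.
have k0 : 0 < kappa by rewrite /kappa divr_gt0//; lra.
have k1 : kappa < 1 by nra.
exists kappa, (r / 2); split; [by []|by rewrite divr_gt0|].
move=> x /cone[xi [xi1 Hx]]; exists xi => // eta rho etak /andP[rho0 rhor].
have xixi : dotp xi xi = 1 by rewrite -enorm_sqr xi1 expr1n.
have /ler_normlP[cs1 cs2] := cauchy_schwarz eta xi; rewrite xi1 mulr1 in cs1 cs2.
set z := xi + eta.
have zxi : 1 - kappa <= dotp z xi by rewrite /z dotpDl xixi; lra.
have z2 : enorm z <= 1 + kappa by apply: le_trans (enormD _ _) _; lra.
have zpos : 0 < enorm z.
  have := le_trans (ler_norm _) (cauchy_schwarz z xi); rewrite xi1 mulr1; lra.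
have -> : rho *: z = (rho * enorm z) *: ((enorm z)^-1 *: z).
  by rewrite scalerA -mulrA divff ?gt_eqF// mulr1.
apply: Hx.
- by rewrite enormZ ger0_norm ?invr_ge0 ?enorm_ge0// mulVf// gt_eqF.
- by rewrite dotpZl mulrC ler_pdivlMr//; nra.
- rewrite mulr_ge0 ?enorm_ge0//=; nra.
Qed.

Lemma coord_le_norm (R : realType) (d : nat) (x : 'rV[R]_d) i :
  `|x ord0 i| <= `|x|.
Proof.
rewrite [leRHS]mx_normrE; apply: (le_trans _ (le_bigmax _ _ (ord0, i))).
by [].
Qed.

(** The infimum in the fill distance is over a finite set and hence attained. *)
Lemma fill_distanceP (R : realType) (d n : nat) (Omega : set 'rV[R]_d)
    (X : 'I_n -> 'rV[R]_d) : compact Omega -> design Omega X ->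
  forall x, Omega x -> exists j, enorm (x - X j) <= fill_distance X Omega.
Proof.
move=> cO [n0 _ OX] x Ox.
pose D y := [set enorm (y - X j) | j in [set: 'I_n]].
have fD y : finite_set (D y) by apply: finite_image; exact: finite_finset.
have D0 y : D y !=set0 by exists (enorm (y - X (Ordinal n0))), (Ordinal n0).
have lD y : has_lbound (D y) by exists 0 => _ [j _ <-]; exact: enorm_ge0.
have [j xj] : exists j, enorm (x - X j) = inf (D x).
  have /= [k _ kmin] := @arg_minP _ _ _ (Ordinal n0) xpredT
    (fun j => enorm (x - X j)) isT.
  exists k; apply/eqP; rewrite eq_le; apply/andP; split.
    by apply: lb_le_inf => // _ [j _ <-]; exact: kmin.
  by apply: ge_inf => //; exists k.
exists j; rewrite xj; apply: sup_upper_bound; last by exists x.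
split; first by exists (inf (D x)), x.
have [M [_ HM]] := compact_bounded cO.
have {}HM y : Omega y -> `|y| <= M + 1 by move=> Oy; apply: HM; rewrite // ltrDl.
have M0 : 0 <= M + 1 by exact: le_trans (normr_ge0 _) (HM _ Ox).
exists (d%:R * ((M + 1) + (M + 1))) => _ [y Oy <-].
apply: (@le_trans _ _ (enorm (y - X (Ordinal n0)))).
  by apply: (ge_inf (lD y)); exists (Ordinal n0).
apply: enorm_le_coord; first by rewrite addr_ge0.
move=> i; rewrite !mxE (le_trans (ler_normB _ _))// lerD//.
  exact: le_trans (coord_le_norm y i) (HM _ Oy).
exact: le_trans (coord_le_norm _ i) (HM _ (OX _)).
Qed.

(** * Stable interpolation at a perturbed grid *)

(** A matrix whose distance to the identity is small in every entry is
    invertible, and its inverse has norm at most [2]: if [w] is largest at [i],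
    then [w i] differs from [(w *m M) i] by at most [`|w i| / 2]. *)
Lemma near_identity_solve (R : realType) (G : finType) (A : G -> G -> R)
    (u : G -> R) (U : R) :
  (forall g b, `|A g b - (g == b)%:R| <= (2 * #|G|%:R)^-1) ->
  (forall b, `|u b| <= U) ->
  exists2 v : G -> R, forall g, `|v g| <= 2 * U &
    forall b, \sum_g v g * A g b = u b.
Proof.
move=> AI uU.
pose M := \matrix_(i < #|G|, j < #|G|) A (enum_val i) (enum_val j).
have key (w : 'rV[R]_#|G|) c : (forall j, `|(w *m M) ord0 j| <= c) ->
    forall i, `|w ord0 i| <= 2 * c.
  move=> wc i0.
  have /= [i _ imax] := @arg_maxP _ _ _ i0 xpredT (fun j => `|w ord0 j|) isT.
  have N0 : 0 < #|G|%:R :> R.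
    by rewrite ltr0n; apply: leq_ltn_trans (ltn_ord i).
  apply: le_trans (imax i0 isT) _.
  have wE : w ord0 i = (w *m M) ord0 i -
      \sum_j w ord0 j * (A (enum_val j) (enum_val i) - (j == i)%:R).
    apply/eqP; rewrite eq_sym subr_eq mxE; apply/eqP.
    under eq_bigr do rewrite mxE.
    under [in RHS]eq_bigr do rewrite mulrBr.
    rewrite sumrB [X in _ = _ + (_ - X)](bigD1 i)//= eqxx mulr1.
    rewrite [X in _ = _ + (_ - (_ + X))]big1 ?addr0; last first.
      by move=> j /negbTE ->; rewrite mulr0.
    by rewrite addrCA subrr addr0.
  have sm : `|\sum_j w ord0 j * (A (enum_val j) (enum_val i) - (j == i)%:R)|
      <= `|w ord0 i| / 2.
    apply: le_trans (ler_norm_sum _ _ _) _.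
    apply: (@le_trans _ _ (\sum_(j < #|G|) `|w ord0 i| * (2 * #|G|%:R)^-1)).
      apply: ler_sum => j _; rewrite normrM; apply: ler_pM => //.
        exact: imax.
      by rewrite -(inj_eq enum_val_inj) AI.
    rewrite sumr_const card_ord -[leLHS]mulr_natr le_eqVlt; apply/orP; left.
    by apply/eqP; field; lra.
  have := ler_normB ((w *m M) ord0 i)
    (\sum_j w ord0 j * (A (enum_val j) (enum_val i) - (j == i)%:R)).
  rewrite -wE; have := wc i; lra.
have uM : M \in unitmx.
  rewrite -row_free_unit; apply: inj_row_free => w wM.
  apply/rowP => i; rewrite mxE; apply/eqP; rewrite -normr_le0 -(mulr0 2).
  by apply: key => j; rewrite wM mxE normr0.
pose r : 'rV[R]_#|G| := \row_i u (enum_val i).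
have rK : (r *m invmx M) *m M = r by rewrite mulmxKV.
exists (fun g => (r *m invmx M) ord0 (enum_rank g)) => [g|b].
  by apply: key => j; rewrite rK mxE.
have -> : u b = (r *m invmx M *m M) ord0 (enum_rank b).
  by rewrite rK mxE enum_rankK.
rewrite mxE.
rewrite (reindex (@enum_rank G)) /=; last first.
  by exists enum_val => ? _; rewrite ?enum_rankK ?enum_valK.
by apply: eq_bigr => g _; rewrite [M _ _]mxE !enum_rankK.
Qed.

Section tensor_interpolation.
Variables (R : realType) (m d : nat).
Local Notation G := {ffun 'I_d -> 'I_m}.
Implicit Types (g b : G) (y : 'rV[R]_d).

Definition lagrange1 (k : 'I_m) : {poly R} :=
  tnth (qpoly.lagrange m (fun k => k%:R : R)) k.

Definition tensor_lagrange g y : R := \prod_i (lagrange1 (g i)).[y ord0 i].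

Definition grid_point g : 'rV[R]_d := \row_i (g i)%:R.

Definition grid_interpolated (q : 'rV[R]_d -> R) :=
  forall y, q y = \sum_g q (grid_point g) * tensor_lagrange g y.

Let natr_inj : injective (fun k => k%:R : R).
Proof. by move=> i j /eqP; rewrite eqr_nat => /eqP. Qed.

Lemma lagrange1_gen (p : {poly R}) t : (size p <= m)%N ->
  p.[t] = \sum_(k < m) p.[k%:R] * (lagrange1 k).[t].
Proof.
move=> sp; have [m0|m0] := posnP m.
  have -> : p = 0 by apply/eqP; rewrite -size_poly_eq0 -leqn0 -m0.
  by rewrite horner0 big1// => k _; rewrite horner0 mul0r.
have /(congr1 (fun q => q.[t])) := qpoly.lagrange_gen m0 natr_inj sp.
rewrite horner_sum => ->; apply: eq_bigr => k _.
by rewrite hornerM hornerC.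
Qed.

Lemma tensor_lagrange_grid b g :
  tensor_lagrange b (grid_point g) = (g == b)%:R.
Proof.
have l1 (k j : 'I_m) : (lagrange1 k).[j%:R] = (k == j)%:R.
  apply: (qpoly.lagrange_sample _ natr_inj).
  exact: leq_ltn_trans (ltn_ord k).
rewrite /tensor_lagrange; have [<-|gb] := eqVneq g b.
  by apply: big1 => i _; rewrite mxE l1 eqxx.
have [i gbi] : exists i, g i != b i.
  apply/existsP; apply: contraNT gb; rewrite negb_exists => /forallP gb.
  by apply/eqP/ffunP => i; move: (gb i); rewrite negbK => /eqP.
by rewrite (bigD1 i)//= mxE l1 eq_sym (negbTE gbi) mul0r.
Qed.

Lemma grid_interpolatedD q1 q2 : grid_interpolated q1 ->
  grid_interpolated q2 -> grid_interpolated (fun y => q1 y + q2 y).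
Proof.
move=> i1 i2 y; rewrite i1 i2 -big_split; apply: eq_bigr => g _.
by rewrite mulrDl.
Qed.

Lemma grid_interpolatedZ a q : grid_interpolated q ->
  grid_interpolated (fun y => a * q y).
Proof.
by move=> i1 y; rewrite i1 mulr_sumr; apply: eq_bigr => g _; rewrite mulrA.
Qed.

Lemma grid_interpolated0 : grid_interpolated (fun=> 0).
Proof. by move=> y; rewrite big1// => g _; rewrite mul0r. Qed.

Lemma grid_interpolated_sum (I : Type) (s : seq I) (P : pred I)
    (q : I -> 'rV[R]_d -> R) : (forall i, grid_interpolated (q i)) ->
  grid_interpolated (fun y => \sum_(i <- s | P i) q i y).
Proof.
move=> qi; elim: s => [|i s IH].
  by under eq_fun do rewrite big_nil; exact: grid_interpolated0.
under eq_fun do rewrite big_cons; case: (P i) => //.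
exact: grid_interpolatedD.
Qed.

Lemma grid_interpolated_monomial (e : 'I_d -> nat) : (forall i, e i < m)%N ->
  grid_interpolated (fun y => \prod_i y ord0 i ^+ e i).
Proof.
move=> em y.
have -> : \prod_i y ord0 i ^+ e i =
    \prod_i \sum_(k < m) k%:R ^+ e i * (lagrange1 k).[y ord0 i].
  apply: eq_bigr => i _; rewrite -hornerXn.
  rewrite (@lagrange1_gen 'X^(e i)) ?size_polyXn//.
  by apply: eq_bigr => k _; rewrite hornerXn.
rewrite bigA_distr_bigA/=; apply: eq_bigr => g _.
by rewrite big_split/=; congr (_ * _); apply: eq_bigr => i _; rewrite mxE.
Qed.

(** Expanding [dotp b y ^+ k] over all maps ['I_k -> 'I_d] gives monomials in
    which no variable has degree larger than [k]. *)
Lemma grid_interpolated_dotpX (b : 'rV[R]_d) k : (k < m)%N ->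
  grid_interpolated (fun y => dotp b y ^+ k).
Proof.
move=> km.
have -> : (fun y => dotp b y ^+ k) = (fun y => \sum_(f : {ffun 'I_k -> 'I_d})
    (\prod_s b ord0 (f s)) * \prod_i y ord0 i ^+ #|[pred s | f s == i]|).
  apply/funext => y; rewrite -[in LHS](card_ord k) -prodr_const /dotp.
  rewrite bigA_distr_bigA/=; apply: eq_bigr => f _.
  rewrite big_split/=; congr (_ * _).
  rewrite (partition_big f xpredT)//=; apply: eq_bigr => i _.
  rewrite -prodr_const; apply: eq_big => [s|s /eqP->//].
  by rewrite inE.
apply: grid_interpolated_sum => f; apply: grid_interpolatedZ.
apply: grid_interpolated_monomial => i; apply: leq_ltn_trans km.
by rewrite -[leqRHS](card_ord k) max_card.
Qed.

Lemma grid_interpolated_affineX a (b : 'rV[R]_d) k : (k < m)%N ->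
  grid_interpolated (fun y => (a + dotp b y) ^+ k).
Proof.
move=> km; under eq_fun do rewrite exprDn.
apply: grid_interpolated_sum => i.
under eq_fun do rewrite -mulrnAl.
apply: grid_interpolatedZ; apply: grid_interpolated_dotpX.
by apply: leq_trans (ltn_ord i) _.
Qed.

Lemma tensor_lagrange_bounded (B : R) : exists2 U : R, 0 < U &
  forall g y, (forall i, `|y ord0 i| <= B) -> `|tensor_lagrange g y| <= U.
Proof.
pose U1 (k : 'I_m) := \sum_(i < size (lagrange1 k)) `|(lagrange1 k)`_i| * `|B| ^+ i.
have U10 k : 0 <= U1 k by apply: sumr_ge0 => i _; rewrite mulr_ge0 ?exprn_ge0.
pose U := 1 + \sum_k U1 k.
have U0 : 0 < U by rewrite ltr_pwDl// sumr_ge0.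
exists (U ^+ d); first exact: exprn_gt0.
move=> g y yB; rewrite normr_prod -[in leRHS](card_ord d) -prodr_const.
apply: ler_prod => i _; rewrite normr_ge0/= horner_coef.
apply: le_trans (ler_norm_sum _ _ _) _.
apply: (@le_trans _ _ (U1 (g i))).
  apply: ler_sum => j _; rewrite normrM normrX ler_wpM2l//.
  by rewrite lerXn2r ?nnegrE// (le_trans (yB i))// ler_norm.
rewrite /U (bigD1 (g i))//= addrCA lerDl.
by rewrite addr_ge0// sumr_ge0.
Qed.

Lemma tensor_lagrange_continuous b : continuous (tensor_lagrange b).
Proof.
move=> y; apply: (cvg_big (@mul_continuous R) (nbhs_filter y)) => i _.
apply: (continuous_comp (f := fun y : 'rV[R]_d => y ord0 i)).
  exact: coord_continuous.
exact: continuous_horner.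
Qed.

Lemma tensor_lagrange_near_grid (eta : R) : 0 < eta ->
  exists2 delta : R, 0 < delta & forall g b (e : 'rV[R]_d),
    (forall i, `|e ord0 i| <= delta) ->
    `|tensor_lagrange b (grid_point g + e) - (g == b)%:R| <= eta.
Proof.
move=> eta0.
have : \forall e \near (0 : 'rV[R]_d), forall gb : G * G,
    `|tensor_lagrange gb.2 (grid_point gb.1 + e) - (gb.1 == gb.2)%:R| < eta.
  apply: (@filter_forall _ _ (fun (gb : G * G) (e : 'rV[R]_d) => is_true
    (`|tensor_lagrange gb.2 (grid_point gb.1 + e) - (gb.1 == gb.2)%:R| < eta))
    _ (nbhs_filter (0 : 'rV[R]_d))) => -[g b]/=.
  have : tensor_lagrange b (grid_point g + e) @[e --> (0 : 'rV[R]_d)]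
      --> tensor_lagrange b (grid_point g).
    rewrite -[in X in _ --> X](addr0 (grid_point g)).
    have Hc : (grid_point g + e) @[e --> (0 : 'rV[R]_d)] --> grid_point g + 0.
      exact: (cvgD (cvg_cst _) cvg_id).
    exact: (cvg_comp _ _ Hc (@tensor_lagrange_continuous b _)).
  rewrite tensor_lagrange_grid => /cvgr_dist_lt /(_ _ eta0).
  by apply: filterS => e; rewrite distrC.
move=> /nbhs_ballP[delta /= delta0 H].
exists (delta / 2); first by rewrite divr_gt0.
move=> g b e ed; have /H/(_ (g, b))/ltW// : ball (0 : 'rV[R]_d) delta e.
split=> // i j; rewrite ord1 mxE -ball_normE/= sub0r normrN.
by rewrite (le_lt_trans (ed j))// ltr_pdivrMr// ltr_pMr// ltr1n.
Qed.

(** Evaluation at any point [y] of a fixed cube is a bounded combination of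
    evaluations at the perturbed grid points [grid_point g + e g], exactly for
    powers of affine functions: the exact tensor interpolation at the grid is
    corrected by inverting the matrix of the Lagrange basis at the perturbed
    points, which is close to the identity. *)
Lemma perturbed_grid_reproduction (B : R) :
  exists delta V : R, [/\ 0 < delta, 0 < V &
    forall (y : 'rV[R]_d) (e : G -> 'rV[R]_d),
      (forall i, `|y ord0 i| <= B) -> (forall g i, `|e g ord0 i| <= delta) ->
      exists2 v : G -> R, \sum_g `|v g| <= V &
        forall a (b : 'rV[R]_d) k, (k < m)%N ->
          \sum_g v g * (a + dotp b (grid_point g + e g)) ^+ k =
          (a + dotp b y) ^+ k].
Proof.
have [U U0 HU] := tensor_lagrange_bounded B.
have eta0 : 0 < (2 * (#|{: G}|%:R + 1))^-1 :> R.
  by rewrite invr_gt0 mulr_gt0// ltr_wpDl.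
have [delta delta0 Hd] := tensor_lagrange_near_grid eta0.
exists delta, (#|{: G}|%:R * (2 * U) + 1); split => //.
  by rewrite ltr_wpDl// mulr_ge0// mulr_ge0// ltW.
move=> y e yB ed.
have [g b|b|v vU vE] := @near_identity_solve R {: G}
  (fun g b => tensor_lagrange b (grid_point g + e g))
  (fun b => tensor_lagrange b y) U.
- apply: le_trans (Hd g b (e g) (ed g)) _.
  have N0 : 0 < #|{: G}|%:R :> R by rewrite ltr0n; apply/card_gt0P; exists g.
  by rewrite lef_pV2 ?posrE ?mulr_gt0 ?ltr_wpDl//; rewrite ler_pM2l// lerDl.
- exact: HU.
exists v.
  apply: (@le_trans _ _ (\sum_(g : G) 2 * U)); first exact: ler_sum.
  by rewrite sumr_const -[leLHS]mulr_natl lerDl.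
move=> a b k km; have qi := grid_interpolated_affineX a b km.
under eq_bigr do rewrite qi mulr_sumr.
rewrite exchange_big/= qi; apply: eq_bigr => c _.
rewrite -vE mulr_sumr; apply: eq_bigr => g _.
by rewrite mulrCA.
Qed.

End tensor_interpolation.

(** * Local polynomial reproduction and the exponential *)

(** In coordinates centred at [x + rho xi] and scaled by [rho s], a ball inside
    the cone at [x] contains the integer grid, and [x] itself stays in a fixed
    cube.  For [rho] a large multiple of the fill distance [h] every grid point
    has a design point within a small distance, so the weights come from
    [perturbed_grid_reproduction]. *)
Lemma local_polynomial_reproduction (R : realType) (d m : nat)
    (Omega : set 'rV[R]_d) : compact Omega -> interior_cone_condition Omega ->
  exists h0 c V : R, [/\ 0 < h0, 0 < c, 0 < V &
    forall (n : nat) (X : 'I_n -> 'rV[R]_d), design Omega X ->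
      0 < fill_distance X Omega <= h0 ->
      forall x, Omega x -> exists a : 'I_n -> R,
        [/\ \sum_j `|a j| <= V,
            forall j, a j != 0 -> enorm (X j - x) <= c * fill_distance X Omega &
            forall w k, (k < m)%N ->
              \sum_j a j * dotp w (X j - x) ^+ k = (k == 0)%:R]].
Proof.
move=> cO /cone_contains_ball[kappa [r [kappa0 r0 cone]]].
pose s := kappa / (d%:R * m%:R + 1).
have dm0 : 0 < d%:R * m%:R + 1 :> R by rewrite ltr_wpDl.
have s0 : 0 < s by rewrite divr_gt0.
have [delta [V [delta0 V0 repr]]] := @perturbed_grid_reproduction R m d s^-1.
(* c h = h + rho (1 + kappa) bounds the distance from x to the design points used *)
exists (r * (s * delta)), (1 + (1 + kappa) / (s * delta)), V; split => //.
- by rewrite !mulr_gt0.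
- by rewrite addr_gt0// divr_gt0 ?mulr_gt0// addr_gt0.
move=> n X DX /andP[]; set h := fill_distance X Omega => h0 hr x Ox.
have [xi xi1 Hxi] := cone _ Ox.
(* fill distance h becomes delta in grid coordinates, where the mesh is rho s *)
pose rho := h / (s * delta).
have rho0 : 0 < rho by rewrite divr_gt0 ?mulr_gt0.
have rhor : rho <= r by rewrite ler_pdivrMr ?mulr_gt0.
have gk (g : {ffun 'I_d -> 'I_m}) : enorm (s *: grid_point R g) <= kappa.
  rewrite enormZ (gtr0_norm s0) /s mulrAC ler_pdivrMr// ler_pM2l//.
  rewrite ler_wpDr//; apply: enorm_le_coord => // i.
  by rewrite mxE normr_nat ler_nat ltnW.
pose z (g : {ffun 'I_d -> 'I_m}) := x + rho *: (xi + s *: grid_point R g).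
have Oz g : Omega (z g) by apply: Hxi; [exact: gk|rewrite ltW].
have /choice[J HJ] : forall g, exists j, enorm (z g - X j) <= h.
  by move=> g; exact: fill_distanceP.
pose e g := (rho * s)^-1 *: (X (J g) - z g).
have XE g : X (J g) - x = rho *: (xi + s *: (grid_point R g + e g)).
  have se : s *: e g = rho^-1 *: (X (J g) - z g).
    by rewrite scalerA invfM mulrCA divff ?gt_eqF// mulr1.
  rewrite [s *: (_ + _)]scalerDr se addrA scalerDr [rho *: (rho^-1 *: _)]scalerA.
  by rewrite divff ?gt_eqF// scale1r [RHS]addrC opprD addrA subrK.
have [||v vV vE] := repr (- s^-1 *: xi) e.
- move=> i; rewrite mxE normrM normrN [`|s^-1|]gtr0_norm ?invr_gt0//.
  by rewrite -[leRHS]mulr1 ler_pM2l ?invr_gt0// -xi1 enorm_coord.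
- have rs0 : 0 < (rho * s)^-1 by rewrite invr_gt0 mulr_gt0.
  have -> : delta = (rho * s)^-1 * h.
    by rewrite /rho; field; rewrite (gt_eqF h0) (gt_eqF s0) (gt_eqF delta0).
  move=> g i; rewrite mxE normrM (gtr0_norm rs0) ler_pM2l//.
  by apply: le_trans (enorm_coord _ _) _; rewrite -enormN opprB.
(* several grid points may share a design point, whose weights are then added *)
exists (fun j => \sum_(g | J g == j) v g); split.
- apply: le_trans vV; rewrite [leRHS](partition_big J xpredT)//=.
  by apply: ler_sum => j _; exact: ler_norm_sum.
- move=> j aj; have [g /eqP <-] : exists g, J g == j.
    apply/existsP; apply: contraNT aj; rewrite negb_exists => /forallP aj.
    by rewrite big1// => g Jg; move: (aj g); rewrite Jg.
  have -> : X (J g) - x = (X (J g) - z g) + (z g - x) by rewrite addrA subrK.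
  apply: le_trans (enormD _ _) _; rewrite mulrDl mul1r lerD//.
    by rewrite -enormN opprB.
  rewrite /z addrAC subrr add0r enormZ gtr0_norm// -mulrA [_ * h]mulrC -/rho.
  rewrite mulrC ler_pM2r//; apply: le_trans (enormD _ _) _.
  by rewrite xi1 lerD2l.
- move=> w k km; have := vE (rho * dotp w xi) ((rho * s) *: w) k km.
  have -> : rho * dotp w xi + dotp (rho * s *: w) (- s^-1 *: xi) = 0.
    by rewrite dotpZl dotpZr; field; rewrite gt_eqF.
  rewrite expr0n => <-.
  under eq_bigr do rewrite mulr_suml.
  rewrite [RHS](partition_big J xpredT)//=.
  apply: eq_bigr => j _; apply: eq_bigr => g /eqP <-.
  by rewrite XE dotpZr dotpDr dotpZr dotpZl; congr (_ * _ ^+ _); ring.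
Qed.

Lemma primitive_poly (R : realType) (c : R) m (q : {poly R}) : (size q <= m)%N ->
  exists p : {poly R}, [/\ (size p <= m.+1)%N, p^`() = q & p.[0] = c].
Proof.
move=> qm; exists (\poly_(i < m.+1) (if i is j.+1 then q`_j / i%:R else c)).
split; first exact: size_poly.
  apply/polyP => i; rewrite coef_deriv coef_poly ltnS.
  case: ltnP => im; last by rewrite mul0rn nth_default// (leq_trans qm).
  by rewrite -[LHS]mulr_natr -mulrA mulVf ?mulr1// pnatr_eq0.
by rewrite horner_coef0 coef_poly.
Qed.

Lemma le_pow_of_derive (R : realType) (f f' : R -> R) m : f 0 = 0 ->
  (forall t : R, is_derive t 1 f (f' t)) -> (forall t, `|f' t| <= `|t| ^+ m) ->
  forall t, `|f t| <= `|t| ^+ m.+1.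
Proof.
move=> f0 df f'm t.
have cf : continuous f.
  by move=> y; apply/differentiable_continuous/derivable1_diffP; case: (df y).
have [c ct ->] : exists2 c, `|c| <= `|t| & f t = f' c * t.
  have [t0|t0] := lerP 0 t.
    have [c /itvP ct] := MVT_segment t0 (fun y _ => df y) (continuous_subspaceT cf).
    rewrite f0 !subr0 => ->; exists c => //.
      by rewrite !ger0_norm// ct.
  have [c /itvP ct] :=
    MVT_segment (ltW t0) (fun y _ => df y) (continuous_subspaceT cf).
  rewrite f0 !sub0r mulrN => /oppr_inj ->.
  exists c => //; rewrite (@ler0_norm _ c) ?ct// (@ler0_norm _ t) ?(ltW t0)//.
  by rewrite lerN2 ct.
rewrite normrM exprSr ler_wpM2r//; apply: le_trans (f'm c) _.
by rewrite lerXn2r ?nnegrE.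
Qed.

(** Integrating a remainder of order [m] of one function gives a remainder of
    order [m + 1] of the other; dropping the factorials keeps the constant [1]. *)
Lemma cos_sin_taylor (R : realType) m : exists p q : {poly R},
  [/\ (size p <= m)%N, (size q <= m)%N,
      forall t, `|cos t - p.[t]| <= `|t| ^+ m &
      forall t, `|sin t - q.[t]| <= `|t| ^+ m].
Proof.
elim: m => [|m [p [q [pm qm cp sq]]]].
  exists 0, 0; rewrite size_poly0; split => // t; rewrite horner0 subr0 expr0.
    by rewrite ler_norml cos_geN1 cos_le1.
  by rewrite ler_norml sin_geN1 sin_le1.
have Nqm : (size (- q) <= m)%N by rewrite size_polyN.
have [p' [p'm dp' p'0]] := primitive_poly 1 Nqm.
have [q' [q'm dq' q'0]] := primitive_poly 0 pm.
exists p', q'; split => // t.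
- apply: (@le_pow_of_derive _ (fun t => cos t - p'.[t])
    (fun t => - sin t - (p'^`()).[t])) => [|y].
  + by rewrite cos0 p'0 subrr.
  + by rewrite dp' hornerN -opprD normrN.
- apply: (@le_pow_of_derive _ (fun t => sin t - q'.[t])
    (fun t => cos t - (q'^`()).[t])) => [|y].
  + by rewrite sin0 q'0 subrr.
  + by rewrite dq'.
Qed.

(** Weights that reproduce polynomials of degree less than [m] at [0]
    approximate [exp (i t)] at [0] to order [m]: only the Taylor remainder of
    the exponential contributes. *)
Lemma exp_sum_error (R : realType) (n m : nat) (a t : 'I_n -> R) (V b : R) :
  (0 < m)%N -> \sum_j `|a j| <= V ->
  (forall j, a j != 0 -> `|t j| <= b) ->
  (forall k, (k < m)%N -> \sum_j a j * t j ^+ k = (k == 0)%:R) ->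
  (1 - \sum_j a j * cos (t j)) ^+ 2 + (\sum_j a j * sin (t j)) ^+ 2 <=
    2 * (1 + V) ^+ 2 * Num.min 1 (`|b| ^+ m) ^+ 2.
Proof.
move=> m0 aV tb rep.
have V0 : 0 <= V by apply: le_trans aV; apply: sumr_ge0.
have [p [q [pm qm cp sq]]] := cos_sin_taylor R m.
have repp (r : {poly R}) : (size r <= m)%N -> \sum_j a j * r.[t j] = r.[0].
  move=> rm; under eq_bigr do rewrite (horner_coef_wide _ rm) mulr_sumr.
  rewrite exchange_big/= (horner_coef_wide _ rm); apply: eq_bigr => k _.
  rewrite expr0n -(rep k (ltn_ord k)) mulr_sumr.
  by apply: eq_bigr => j _; rewrite mulrCA.
have p0 : p.[0] = 1.
  have := cp 0; rewrite cos0 normr0 expr0n gtn_eqF//= normr_le0 subr_eq0.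
  by move=> /eqP.
have q0 : q.[0] = 0.
  have := sq 0; rewrite sin0 normr0 expr0n gtn_eqF//= normr_le0 sub0r oppr_eq0.
  by move=> /eqP.
have rem (f : R -> R) (r : {poly R}) : (forall u, `|f u - r.[u]| <= `|u| ^+ m) ->
    (size r <= m)%N -> `|r.[0] - \sum_j a j * f (t j)| <= V * `|b| ^+ m.
  move=> fr rm; rewrite -(repp _ rm) -sumrB.
  apply: le_trans (ler_norm_sum _ _ _) _.
  apply: (@le_trans _ _ (\sum_j `|a j| * `|b| ^+ m)).
    apply: ler_sum => j _; rewrite -mulrBr normrM distrC.
    have [->|aj] := eqVneq (a j) 0; first by rewrite normr0 !mul0r.
    rewrite ler_wpM2l//; apply: le_trans (fr _) _.
    by rewrite lerXn2r ?nnegrE// (le_trans (tb _ aj))// ler_norm.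
  by rewrite -mulr_suml ler_wpM2r// exprn_ge0.
have triv (f : R -> R) (c : R) : (forall u, `|f u| <= 1) -> `|c| <= 1 ->
    `|c - \sum_j a j * f (t j)| <= 1 + V.
  move=> f1 c1; apply: le_trans (ler_normB _ _) _; rewrite lerD//.
  apply: le_trans aV; apply: le_trans (ler_norm_sum _ _ _) _.
  by apply: ler_sum => j _; rewrite normrM ler_piMr.
have fin (f : R -> R) (r : {poly R}) : (forall u, `|f u| <= 1) ->
    `|r.[0]| <= 1 -> (forall u, `|f u - r.[u]| <= `|u| ^+ m) ->
    (size r <= m)%N -> (r.[0] - \sum_j a j * f (t j)) ^+ 2 <=
      (1 + V) ^+ 2 * Num.min 1 (`|b| ^+ m) ^+ 2.
  move=> f1 r1 fr rm; rewrite -exprMn -real_normK ?num_real//.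
  have M0 : 0 <= Num.min 1 (`|b| ^+ m) by rewrite le_min ler01 exprn_ge0.
  rewrite lerXn2r ?nnegrE ?mulr_ge0 ?addr_ge0//.
  rewrite minEle; case: ifP => _; first by rewrite mulr1 triv.
  by apply: le_trans (rem _ _ fr rm) _; rewrite ler_wpM2r ?exprn_ge0// lerDr.
have c1 : forall u : R, `|cos u| <= 1.
  by move=> u; rewrite ler_norml cos_geN1 cos_le1.
have s1 : forall u : R, `|sin u| <= 1.
  by move=> u; rewrite ler_norml sin_geN1 sin_le1.
rewrite -mulrA mulr_natl mulr2n lerD//.
  by have := fin cos p c1; rewrite p0 normr1 => /(_ (lexx _) cp pm).
have := fin sin q s1; rewrite q0 normr0 => /(_ ler01 sq qm).
by rewrite sub0r sqrrN.
Qed.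

(** * Measurability and Lebesgue measure on row vectors *)

Section dyadic.
Variables (R : realType) (d : nat).

Definition dyadic_floor (k : nat) (x : 'rV[R]_d) : 'rV[int]_d :=
  \row_i Num.floor (2 ^+ k * x ord0 i).

Definition dyadic_point (k : nat) (z : 'rV[int]_d) : 'rV[R]_d :=
  \row_i ((z ord0 i)%:~R / 2 ^+ k).

Lemma measurable_dyadic_cell k z :
  measurable [set x : 'rV[R]_d | dyadic_floor k x = z].
Proof.
have -> : [set x | dyadic_floor k x = z] = \bigcap_(i in [set: 'I_d])
    ((fun x : 'rV[R]_d => x ord0 i) @^-1`
      `[(z ord0 i)%:~R / 2 ^+ k, (z ord0 i + 1)%:~R / 2 ^+ k[).
  apply/seteqP; split=> x /=.
    move=> <- i _ /=; rewrite in_itv/= mxE ler_pdivrMr ?exprn_gt0//.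
    by rewrite ltr_pdivlMr ?exprn_gt0// mulrC floor_le floorD1_gt.
  move=> H; apply/rowP => i; rewrite mxE; apply: floor_def.
  have := H i I; rewrite /= in_itv/= ler_pdivrMr ?exprn_gt0//.
  by rewrite ltr_pdivlMr ?exprn_gt0// mulrC.
apply: fin_bigcap_measurable; first exact: finite_finset.
move=> i _; rewrite -[X in measurable X]setTI.
exact: measurable_rV_coord.
Qed.

Lemma dyadic_floor_dist k (x y : 'rV[R]_d) i :
  dyadic_floor k x = dyadic_floor k y -> `|x ord0 i - y ord0 i| <= (2 ^+ k)^-1.
Proof.
move=> /rowP/(_ i); rewrite !mxE => xy.
have k0 : 0 < 2 ^+ k :> R by rewrite exprn_gt0.
rewrite -(ler_pM2l k0) divff ?gt_eqF// -[X in X * `|_|](gtr0_norm k0).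
rewrite -normrM mulrBr ler_norml.
have := floor_le (2 ^+ k * x ord0 i); have := floorD1_gt (2 ^+ k * x ord0 i).
have := floor_le (2 ^+ k * y ord0 i); have := floorD1_gt (2 ^+ k * y ord0 i).
by rewrite xy !intrD; lra.
Qed.

Lemma dyadic_pointK k z : dyadic_floor k (dyadic_point k z) = z.
Proof.
apply/rowP => i; rewrite !mxE mulrC divfK ?gt_eqF ?exprn_gt0//.
exact: intrKfloor.
Qed.

Lemma dyadic_cvg (x : 'rV[R]_d) (y : nat -> 'rV[R]_d) :
  (forall k, dyadic_floor k x = dyadic_floor k (y k)) -> y @ \oo --> x.
Proof.
move=> xy; apply/cvgrPdist_lt => e e0.
have : (fun k => (2 ^+ k)^-1 : R) @ \oo --> (0 : R).
  under eq_fun do rewrite -exprVn.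
  by apply: cvg_expr; rewrite ger0_norm// invf_lt1// ltr1n.
move=> /cvgrPdist_lt /(_ _ e0); apply: filterS => k.
rewrite sub0r normrN ger0_norm ?invr_ge0 ?exprn_ge0// => ke.
apply: le_lt_trans ke; rewrite [leLHS]mx_normrE.
apply: bigmax_le => [|[j i] _]; first by rewrite invr_ge0 exprn_ge0.
by rewrite /= ord1 !mxE; exact: dyadic_floor_dist.
Qed.

(** A function of two arguments that is continuous in the first and measurable
    in the second is a limit of functions that are constant in the first
    argument on dyadic cells. *)
Lemma caratheodory_measurable dT (T : measurableType dT)
    (g : 'rV[R]_d * T -> R) :
  (forall t, continuous (fun x => g (x, t))) ->
  (forall x, measurable_fun setT (fun t => g (x, t))) ->
  measurable_fun setT g.
Proof.
move=> cg mg.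
pose h k (p : 'rV[R]_d * T) := g (dyadic_point k (dyadic_floor k p.1), p.2).
apply: (@measurable_fun_cvg _ _ _ setT h); last first.
  move=> [x t] _; rewrite /h/=.
  apply: (cvg_comp (fun k => dyadic_point k (dyadic_floor k x))
    (fun x => g (x, t))); last exact: cg.
  by apply: dyadic_cvg => k; rewrite dyadic_pointK.
move=> k _ B mB; rewrite setTI.
have -> : h k @^-1` B = \bigcup_(z : 'rV[int]_d)
   ([set x | dyadic_floor k x = z] `*`
      ((fun t => g (dyadic_point k z, t)) @^-1` B)).
  apply/seteqP; split=> [[x t] /= Bx|[x t] /= [z _ [/= <-]]//].
  by exists (dyadic_floor k x).
apply: countable_bigcupT_measurable => [|z].
  exact: countableP.
apply: measurableX; first exact: measurable_dyadic_cell.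
by rewrite -[X in measurable X]setTI; exact: mg.
Qed.

(** A point lies in a closed set as soon as its dyadic cells of all levels meet
    the set. *)
Lemma closed_measurable_rV (A : set 'rV[R]_d) : closed A -> measurable A.
Proof.
move=> cA.
have -> : A = \bigcap_k \bigcup_(z in [set: 'rV[int]_d])
    [set x | dyadic_floor k x = z /\
       exists2 y, A y & dyadic_floor k y = z].
  apply/seteqP; split=> [x Ax k _|x H].
    by exists (dyadic_floor k x) => //; split=> //; exists x.
  have /choice[y Hy] : forall k, exists y,
      A y /\ dyadic_floor k x = dyadic_floor k y.
    by move=> k; have [z _ [-> [y Ay <-]]] := H k I; exists y.
  apply: (closed_cvg _ cA _ _ (dyadic_cvg (fun k => (Hy k).2))).
  by apply: nearW => k; case: (Hy k).
apply: bigcapT_measurable => k; apply: countable_bigcupT_measurable => [|z].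
  exact: countableP.
have [Az|Az] := pselect (exists2 y, A y & dyadic_floor k y = z).
  rewrite [X in measurable X](_ : _ = [set x | dyadic_floor k x = z]).
    exact: measurable_dyadic_cell.
  by apply/seteqP; split=> x /= => [[]|].
rewrite [X in measurable X](_ : _ = set0)//.
by apply/seteqP; split=> x // -[].
Qed.

Lemma compact_measurable_rV (A : set 'rV[R]_d) : compact A -> measurable A.
Proof.
move=> cA; apply: closed_measurable_rV; apply: compact_closed cA.
exact: norm_hausdorff.
Qed.

End dyadic.

Lemma measurable_cube (R : realType) d (a : R) :
  measurable [set x : 'rV[R]_d | forall i, (`|x ord0 i| <= a)%R].
Proof.
rewrite (_ : mkset _ = \bigcap_(i in [set: 'I_d])
   ((fun x : 'rV[R]_d => x ord0 i) @^-1` [set r | `|r| <= a])); last first.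
  by apply/seteqP; split=> x /= H i => [_|]; exact: H.
apply: fin_bigcap_measurable; first exact: finite_finset.
move=> i _; rewrite -[X in measurable X]setTI.
apply: measurable_rV_coord => //.
rewrite (_ : mkset _ = `[- a, a]%classic)//.
by apply/seteqP; split=> r /=; rewrite in_itv/= ler_norml.
Qed.

Lemma lebesgue_rV_cube (R : realType) d (a : R) : 0 <= a ->
  (lebesgue_rV [set x : 'rV[R]_d | forall i, (`|x ord0 i| <= a)%R] =
   ((2 * a) ^+ d)%:E)%E.
Proof.
move=> a0; elim: d => [|d IH].
  rewrite /= /dirac indicE expr0 mem_set// => i; by case: i.
rewrite /= /lebesgue_rV_succ /pushforward.
rewrite (_ : _ @^-1` _ = `[- a, a]%classic `*`
   [set x : 'rV[R]_d | forall i, `|x ord0 i| <= a]); last first.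
  apply/seteqP; split=> [[u x]/= H|[u x]/= [] ].
    split=> /=.
      by have := H ord0; rewrite cons_rV0/= in_itv/= ler_norml.
    by move=> i; have := H (lift ord0 i); rewrite cons_rVS.
  rewrite /= in_itv/= -ler_norml => ua xa i.
  case: (unliftP ord0 i) => [j ->|->]; first by rewrite cons_rVS.
  by rewrite cons_rV0.
rewrite product_measure1E//; last exact: measurable_cube.
rewrite IH [X in (X * _)%E](_ : _ = (2 * a)%:E) -?EFinM ?exprS//.
transitivity (lebesgue_measure `[- a, a]%classic : \bar R); first by [].
rewrite lebesgue_measure_itv/= lte_fin.
by case: ltP => aa; rewrite -?EFinB; congr EFin; lra.
Qed.

Lemma compact_lebesgue_rV_lty (R : realType) d (A : set 'rV[R]_d) :
  compact A -> (lebesgue_rV A < +oo)%E.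
Proof.
move=> cA; have [M [_ HM]] := compact_bounded cA.
pose a := `|M| + 1.
have a0 : 0 <= a by rewrite addr_ge0.
apply: (@le_lt_trans _ _ (lebesgue_rV
    [set x : 'rV[R]_d | forall i, (`|x ord0 i| <= a)%R])); last first.
  by rewrite lebesgue_rV_cube// ltry.
apply: le_measure; rewrite ?inE.
- exact: compact_measurable_rV.
- exact: measurable_cube.
- move=> x Ax i; apply: le_trans (coord_le_norm _ _) _.
  by apply: HM => //; rewrite /a (le_lt_trans (ler_norm _))// ltrDl.
Qed.

(** * Spectral integrals *)

Section trig_square.
Variables (R : realType) (d : nat).

(** [`|sum_i b_i exp (i w.z_i)|^2] *)
Definition trig_square n (b : 'I_n -> R) (z : 'I_n -> 'rV[R]_d) w : R :=
  (\sum_i b i * cos (dotp w (z i))) ^+ 2 + (\sum_i b i * sin (dotp w (z i))) ^+ 2.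

Lemma trig_square_ge0 n (b : 'I_n -> R) z w : 0 <= trig_square b z w.
Proof. by rewrite addr_ge0// sqr_ge0. Qed.

Lemma measurable_dotp (y : 'rV[R]_d) :
  measurable_fun setT (fun w : 'rV[R]_d => dotp w y).
Proof.
rewrite /dotp; apply: measurable_sum => i.
by apply: measurable_funM => //; exact: measurable_rV_coord.
Qed.

Lemma measurable_cos_dotp (y : 'rV[R]_d) :
  measurable_fun setT (fun w : 'rV[R]_d => cos (dotp w y)).
Proof.
apply: (measurableT_comp _ (measurable_dotp y)).
exact: (continuous_measurable_fun (@continuous_cos R)).
Qed.

Lemma measurable_trig_square n (b : 'I_n -> R) z :
  measurable_fun setT (trig_square b z).
Proof.
apply: measurable_funD; apply: measurable_funX; apply: measurable_sum => i.
  by apply: measurable_funM; [exact: measurable_cst|exact: measurable_cos_dotp].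
apply: measurable_funM; first exact: measurable_cst.
apply: (measurableT_comp _ (measurable_dotp (z i))).
exact: (continuous_measurable_fun (@continuous_sin R)).
Qed.

(** The square [`|sum_i b_i exp (i w.z_i)|^2] expands into
    [sum_ij b_i b_j exp (i w.(z_i - z_j))], so a quadratic form in a kernel is
    an integral against the spectral density of that kernel. *)
Lemma spectral_quadratic_form (Psi f : 'rV[R]_d -> R) n
    (b : 'I_n -> R) (z : 'I_n -> 'rV[R]_d) :
  spectral_density Psi f ->
  (\int[lebesgue_rV]_w (trig_square b z w * f w)%:E =
   (\sum_i \sum_j b i * b j * Psi (z i - z j))%:E)%E.
Proof.
move=> [fint fPsi].
have mf : measurable_fun setT f.
  by apply/measurable_EFinP; case/integrableP: fint.
pose g i j w : \bar R := (cos (dotp w (z i - z j)) * f w)%:E.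
have gint i j : lebesgue_rV.-integrable setT (g i j).
  apply: le_integrable fint => //.
    apply/measurable_EFinP; apply: measurable_funM.
      exact: measurable_cos_dotp.
    exact: mf.
  move=> w _ /=; rewrite lee_fin normrM ler_piMl//.
  by rewrite ler_norml cos_geN1 cos_le1.
have gE i j : (\int[lebesgue_rV]_w ((b i * b j)%:E * g i j w) =
    (b i * b j * Psi (z i - z j))%:E)%E.
  by rewrite integralZl// (fPsi _).1.
transitivity (\int[lebesgue_rV]_w \sum_i \sum_j ((b i * b j)%:E * g i j w))%E.
  apply: eq_integral => w _.
  transitivity (\sum_i \sum_j (b i * b j * (cos (dotp w (z i - z j)) * f w)))%:E.
    congr EFin; rewrite /trig_square.
    rewrite !expr2 !mulr_suml -big_split mulr_suml; apply: eq_bigr => i _ /=.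
    rewrite !mulr_sumr -big_split mulr_suml; apply: eq_bigr => j _ /=.
    by rewrite dotpBr cosB; ring.
  by rewrite -sumEFin; apply: eq_bigr => i _; rewrite -sumEFin.
rewrite integral_sum//; last first.
  by move=> i; apply: integrable_sum => // j _; exact: integrableZl.
rewrite -sumEFin; apply: eq_bigr => i _.
rewrite integral_sum//; last by move=> j; exact: integrableZl.
by rewrite -sumEFin; apply: eq_bigr => j _.
Qed.

End trig_square.

Lemma measurable_enorm (R : realType) d :
  measurable_fun setT (@enorm R d).
Proof.
apply: (measurableT_comp (f := @Num.sqrt R)) => //.
  exact: (continuous_measurable_fun (@sqrt_continuous R)).
rewrite /dotp; apply: measurable_sum => i.
by apply: measurable_funM; exact: measurable_rV_coord.
Qed.

Lemma nneseries_le_bound (R : realType) (u : nat -> R) (M : R) :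
  (forall k, 0 <= u k) -> (forall n, \sum_(k < n) u k <= M) ->
  (\sum_(k <oo) (u k)%:E <= M%:E)%E.
Proof.
move=> u0 uM; apply: lime_le.
  by apply: is_cvg_nneseries => k _ _; rewrite lee_fin.
by apply: nearW => n; rewrite /= sumEFin lee_fin big_mkord.
Qed.

Lemma geometric_sum_le (R : realType) (q : R) n : 0 <= q < 1 ->
  \sum_(k < n) q ^+ k <= (1 - q)^-1.
Proof.
move=> /andP[q0 q1]; have q1' : 0 < 1 - q by rewrite subr_gt0.
rewrite -(ler_pM2l q1') divff ?gt_eqF//.
have := subrX1 q n; have := exprn_ge0 n q0; lra.
Qed.

Lemma le_powRN (R : realType) (a b r : R) : 0 < a -> a <= b -> 0 <= r ->
  b `^ (- r) <= a `^ (- r).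
Proof.
move=> a0 ab r0; have b0 := lt_le_trans a0 ab.
by rewrite !powRN lef_pV2 ?posrE ?powR_gt0// ge0_ler_powR// nnegrE ltW.
Qed.

Lemma dyadic_bracket (R : realType) (y : R) : 1 <= y ->
  exists k, 2 ^+ k <= y < 2 ^+ k.+1.
Proof.
move=> y1; have ex : exists k, y < 2 ^+ k.
  exists (Num.truncn y).+1; apply: lt_trans (truncnS_gt y) _.
  by rewrite -natrX ltr_nat ltn_expl.
case: (ex_minnP ex) => -[|k] yk kmin.
  by move: yk; rewrite expr0 ltNge y1.
exists k; rewrite yk andbT leNgt; apply/negP => /kmin.
by rewrite ltnn.
Qed.

Lemma powR_expn_mul (R : realType) (a s t : R) d : 0 < a -> s = t + d%:R ->
  a `^ (- s) * a ^+ d = a `^ (- t).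
Proof.
move=> a0 ->; rewrite -powR_mulrn ?ltW// -powRD; last first.
  by apply/implyP => _; rewrite gt_eqF.
by congr (_ `^ _); ring.
Qed.

Lemma powR_dyadic (R : realType) (h t : R) k : 0 < h ->
  (2 ^+ k / h) `^ (- t) = (2 `^ (- t)) ^+ k * h `^ t.
Proof.
move=> h0; rewrite powRM ?exprn_ge0 ?invr_ge0 ?(ltW h0)//.
rewrite -(powR_inv1 (ltW h0)) -powRrM mulN1r opprK; congr (_ * _).
transitivity ((2 `^ k%:R) `^ (- t)); first by rewrite powR_mulrn.
by rewrite -powRrM mulrC powRrM powR_mulrn ?powR_ge0.
Qed.

Lemma powR_dyadicV (R : realType) (h t : R) k : 0 < h ->
  (2 ^- k / h) `^ (- t) = (2 `^ t) ^+ k * h `^ t.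
Proof.
move=> h0; rewrite powRM ?invr_ge0 ?exprn_ge0 ?(ltW h0)//.
rewrite -(powR_inv1 (ltW h0)) -(@powR_inv1 _ (2 ^+ k)) ?exprn_ge0//.
rewrite -[in X in X * _ = _]powRrM -[in X in _ * X = _]powRrM mulN1r opprK.
congr (_ * _).
transitivity ((2 `^ k%:R) `^ t); first by rewrite powR_mulrn.
by rewrite -powRrM mulrC powRrM powR_mulrn ?powR_ge0.
Qed.

Lemma measurable_decay (R : realType) d (h e : R) m :
  measurable_fun setT (fun w : 'rV[R]_d =>
    Num.min 1 ((h * enorm w) ^+ m) ^+ 2 * (1 + enorm w ^+ 2) `^ e).
Proof.
apply: measurable_funM.
    apply: measurable_funX; apply: measurable_minr; first exact: measurable_cst.
    apply: measurable_funX; apply: measurable_funM; first exact: measurable_cst.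
    exact: measurable_enorm.
  apply: (measurableT_comp (measurable_powR _)).
  apply: measurable_funD; first exact: measurable_cst.
  apply: measurable_funX.
  exact: measurable_enorm.
Qed.

(** Splitting the domain into the dyadic shells [2^k <= h `|w| < 2^(k+1)], each
    contained in a cube, bounds the integral by [h^(2 nu)] times two geometric
    series: the shells outside the ball of radius [1/h] are summable because
    [0 < nu], those inside because [nu < m]. *)
Lemma decay_integral_le (R : realType) (d m : nat) (nu : R) : 0 < nu < m%:R ->
  exists2 C : R, 0 < C & forall h, 0 < h ->
    (\int[lebesgue_rV]_w (Num.min 1 ((h * enorm (w : 'rV[R]_d)) ^+ m) ^+ 2 *
        (1 + enorm w ^+ 2) `^ (- (nu + d%:R / 2)))%:E
     <= (C * h `^ (2 * nu))%:E)%E.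
Proof.
move=> /andP[nu0 num].
pose s := 2 * nu + d%:R.
have s0 : 0 <= s by rewrite addr_ge0// mulr_ge0// ltW.
pose q1 : R := 2 `^ (- (2 * nu)); pose q2 : R := 2 `^ (- (2 * (m%:R - nu))).
have q01 (x : R) : 0 < x -> 0 <= 2 `^ (- (2 * x)) < (1 : R).
  move=> x0; rewrite powR_ge0/= powRN invf_lt1 ?powR_gt0//.
  have x20 : 0 < 2 * x by rewrite mulr_gt0.
  have := gt0_ltr_powR x20 (_ : 1 \in Num.nneg) (_ : 2 \in Num.nneg).
  by rewrite powR1; apply; rewrite ?nnegrE// ltr1n.
have q1b : 0 <= q1 < 1 by exact: q01.
have q2b : 0 <= q2 < 1 by apply: q01; rewrite subr_gt0.
pose C1 : R := 4 ^+ d; pose C2 : R := 4 ^+ d * 2 `^ (2 * nu).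
have C10 : 0 < C1 by rewrite exprn_gt0.
have C20 : 0 < C2 by rewrite mulr_gt0 ?exprn_gt0 ?powR_gt0.
exists (C1 / (1 - q1) + C2 / (1 - q2)).
  by case/andP: q1b => _ ?; case/andP: q2b => _ ?;
    rewrite addr_gt0// divr_gt0// subr_gt0.
move=> h h0.
pose cube (a : R) := [set x : 'rV[R]_d | forall i, `|x ord0 i| <= a].
pose A k : R := (2 ^+ k / h) `^ (- s).
pose B k : R := (2 ^- k) ^+ m ^+ 2 * (2 ^- k.+1 / h) `^ (- s).
have A0 k : 0 <= A k by exact: powR_ge0.
have B0 k : 0 <= B k by rewrite mulr_ge0 ?powR_ge0// sqr_ge0.
(* A bounds the integrand on an outer shell, B on an inner one *)
pose term k (w : 'rV[R]_d) : \bar R :=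
  ((A k)%:E * (\1_(cube (2 ^+ k.+1 / h)) w)%:E +
   (B k)%:E * (\1_(cube (2 ^- k / h)) w)%:E)%E.
have q2k k : q2 ^+ k = (2 ^- k) ^+ m ^+ 2 * (2 `^ (2 * nu)) ^+ k.
  rewrite /q2 (_ : - (2 * (m%:R - nu)) = 2 * nu + - (2 * m)%:R); last first.
    by rewrite natrM; ring.
  rewrite powRD; last by apply/implyP => _; rewrite pnatr_eq0.
  rewrite powR_invn// mulrC exprMn; congr (_ * _).
  by rewrite -!exprVn -!exprM [(2 * m)%N]mulnC [(k * _)%N]mulnC.
have mterm1 (c a : R) : measurable_fun setT
    (fun w : 'rV[R]_d => c%:E * (\1_(cube a) w)%:E)%E.
  apply: measurable_funeM; apply/measurable_EFinP.
  by apply: measurable_indic; exact: measurable_cube.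
have term0 k w : (0 <= term k w)%E.
  by rewrite adde_ge0// mule_ge0 ?lee_fin.
have mterm k : measurable_fun setT (term k) by exact: emeasurable_funD.
have pos2 k : 0 <= 2 ^+ k / h :> R by rewrite divr_ge0 ?exprn_ge0// ltW.
have pos2' k : 0 <= 2 ^- k / h :> R.
  by rewrite divr_ge0 ?invr_ge0 ?exprn_ge0// ltW.
have iterm k : (\int[lebesgue_rV]_w term k w =
    (C1 * h `^ (2 * nu) * q1 ^+ k + C2 * h `^ (2 * nu) * q2 ^+ k)%:E)%E.
  rewrite ge0_integralD//; first last.
  - by move=> w _; rewrite mule_ge0 ?lee_fin.
  - by move=> w _; rewrite mule_ge0 ?lee_fin.
  have mi a : measurable_fun setT (fun w : 'rV[R]_d => (\1_(cube a) w)%:E).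
    by apply/measurable_EFinP/measurable_indic; exact: measurable_cube.
  have icube a : 0 <= a -> (\int[lebesgue_rV]_w (\1_(cube a) w)%:E =
      ((2 * a) ^+ d)%:E)%E.
    move=> a0; rewrite integral_indic ?setIT//; last exact: measurable_cube.
    exact: lebesgue_rV_cube.
  rewrite !ge0_integralZl ?lee_fin// !icube// -!EFinM -EFinD; congr (_ + _)%:E.
    rewrite (_ : 2 * (2 ^+ k.+1 / h) = 4 * (2 ^+ k / h)); last first.
      by rewrite exprS; ring.
    rewrite exprMn -/C1 mulrCA (@powR_expn_mul _ _ _ (2 * nu))//; last first.
      by rewrite divr_gt0// exprn_gt0.
    by rewrite powR_dyadic// -/q1; ring.
  rewrite /B (_ : 2 * (2 ^- k / h) = 4 * (2 ^- k.+1 / h)); last first.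
    by rewrite exprS; field; rewrite gt_eqF//= expf_neq0.
  rewrite exprMn mulrACA (@powR_expn_mul _ _ _ (2 * nu))//.
    rewrite powR_dyadicV// [(2 `^ _) ^+ k.+1]exprS q2k /C2; ring.
  by rewrite divr_gt0// invr_gt0 exprn_gt0.
have pw w : (((Num.min 1 ((h * enorm w) ^+ m) ^+ 2 *
        (1 + enorm w ^+ 2) `^ (- (nu + d%:R / 2)))%:E
     <= \sum_(k <oo) term k w)%E).
  set G := (X in (X%:E <= _)%E).
  have one k (c : R) : G <= c -> (c%:E <= term k w)%E ->
      (G%:E <= \sum_(k <oo) term k w)%E.
    move=> Gc ck; apply: (@le_trans _ _ (term k w)).
      by apply: le_trans ck; rewrite lee_fin.
    apply: (@le_trans _ _ (\sum_(0 <= j < k.+1) term j w)%E).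
      by rewrite big_nat_recr//= leeDr// sume_ge0.
    by apply: nneseries_lim_ge => *.
  have [w0|w0] := eqVneq (enorm w) 0.
    have -> : G = 0.
      rewrite /G w0 mulr0 expr0n gtn_eqF/=; last first.
        by rewrite -(ltr_nat R); exact: lt_trans num.
      by rewrite min_r// expr0n mul0r.
    by apply: nneseries_ge0.
  have wp : 0 < enorm w by rewrite lt_neqAle eq_sym w0 enorm_ge0.
  have G1 : G <= Num.min 1 ((h * enorm w) ^+ m) ^+ 2 * enorm w `^ (- s).
    rewrite /G ler_wpM2l ?sqr_ge0//.
    apply: (@le_trans _ _ ((enorm w ^+ 2) `^ (- (nu + d%:R / 2)))).
      apply: le_powRN; rewrite ?exprn_gt0// ?lerDr//.
      by rewrite addr_ge0// ?(ltW nu0)// divr_ge0.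
    rewrite -powR_mulrn ?enorm_ge0// -powRrM.
    by rewrite (_ : 2 * - (nu + d%:R / 2) = - s)// /s; field.
  have m0 : 0 <= Num.min 1 ((h * enorm w) ^+ m).
    by rewrite le_min ler01 exprn_ge0// mulr_ge0// ltW.
  have [y1|y1] := lerP 1 (h * enorm w).
    have [k /andP[k1 k2]] := dyadic_bracket y1.
    apply: (one k (A k)).
      apply: le_trans G1 _; apply: (@le_trans _ _ (1 * enorm w `^ (- s))).
        by rewrite ler_wpM2r ?powR_ge0// expr_le1// ge_min lexx.
      rewrite mul1r; apply: le_powRN => //; first by rewrite divr_gt0// exprn_gt0.
      by rewrite ler_pdivrMr// mulrC.
    rewrite /term indicE mem_set ?mule1.
      by rewrite leeDl// mule_ge0 ?lee_fin.
    move=> i /=; apply: le_trans (enorm_coord _ _) _.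
    by rewrite ler_pdivlMr// mulrC ltW.
  have y1' : 1 <= (h * enorm w)^-1.
    by rewrite invf_ge1 ?mulr_gt0// ltW.
  have [k /andP[k1 k2]] := dyadic_bracket y1'.
  have yk : h * enorm w <= 2 ^- k.
    by rewrite -[leLHS]invrK lef_pV2 ?posrE ?invr_gt0 ?exprn_gt0 ?mulr_gt0.
  have yk' : 2 ^- k.+1 <= h * enorm w.
    by rewrite -[leRHS]invrK lef_pV2 ?posrE ?invr_gt0 ?exprn_gt0 ?mulr_gt0// ltW.
  apply: (one k (B k)).
    apply: le_trans G1 _; apply: ler_pM; rewrite ?sqr_ge0 ?powR_ge0//.
      rewrite lerXn2r ?nnegrE ?exprn_ge0 ?invr_ge0 ?exprn_ge0//.
      rewrite ge_min; apply/orP; right.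
      by rewrite lerXn2r ?nnegrE ?mulr_ge0 ?invr_ge0 ?exprn_ge0// ?ltW.
    apply: le_powRN => //; first by rewrite divr_gt0// invr_gt0 exprn_gt0.
    by rewrite ler_pdivrMr// mulrC.
  rewrite /term [X in (_ + _ * X%:E)%E]indicE mem_set ?mule1.
    by rewrite leeDr// mule_ge0 ?lee_fin.
  move=> i /=; apply: le_trans (enorm_coord _ _) _.
  by rewrite ler_pdivlMr// mulrC.
apply: (@le_trans _ _ (\int[lebesgue_rV]_w \sum_(k <oo) term k w)%E).
  apply: ge0_le_integral => //.
  - by move=> w _; rewrite lee_fin mulr_ge0 ?sqr_ge0 ?powR_ge0.
  - by apply/measurable_EFinP; exact: measurable_decay.
  - exact: ge0_emeasurable_sum.
rewrite integral_nneseries//.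
under eq_eseriesr do rewrite iterm.
have q1k k : 0 <= q1 ^+ k by case/andP: q1b => ? _; rewrite exprn_ge0.
have q2k0 k : 0 <= q2 ^+ k by case/andP: q2b => ? _; rewrite exprn_ge0.
apply: nneseries_le_bound => [k|n].
  by rewrite addr_ge0// !mulr_ge0 ?powR_ge0// ltW.
rewrite big_split/= -!mulr_sumr [leRHS]mulrDl.
apply: lerD.
  rewrite mulrAC ler_wpM2r ?powR_ge0// ler_wpM2l ?(ltW C10)//.
  exact: geometric_sum_le.
rewrite mulrAC ler_wpM2r ?powR_ge0// ler_wpM2l ?(ltW C20)//.
exact: geometric_sum_le.
Qed.

(** * Variance of the interpolation error *)

Section interpolation_error.
Variables (R : realType) (d n : nat).
Implicit Types (K : 'rV[R]_d -> R) (X : 'I_n -> 'rV[R]_d) (a : 'I_n -> R).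

(** The error functional [Z x - sum_j a_j Z (X j)] as a combination of [n + 1]
    point evaluations. *)
Definition err_weight a (i : 'I_n.+1) : R :=
  if unlift ord0 i is Some j then - a j else 1.

Definition err_point X (x : 'rV[R]_d) (i : 'I_n.+1) : 'rV[R]_d :=
  if unlift ord0 i is Some j then X j else x.

Definition err_form K X x a : R :=
  \sum_i \sum_j err_weight a i * err_weight a j *
    K (err_point X x i - err_point X x j).

Lemma err_sum (F : 'rV[R]_d -> R) X x a :
  \sum_i err_weight a i * F (err_point X x i) = F x - \sum_j a j * F (X j).
Proof.
rewrite big_ord_recl /err_weight /err_point unlift_none mul1r -sumrN.
by congr (_ + _); apply: eq_bigr => j _; rewrite liftK mulNr.
Qed.

Lemma err_formE K X x a : (forall y, K (- y) = K y) ->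
  err_form K X x a = K 0 - 2 * (\sum_j a j * K (x - X j)) +
    \sum_i \sum_j a i * a j * K (X i - X j).
Proof.
move=> Ksym; rewrite /err_form.
have row i : \sum_j err_weight a i * err_weight a j *
    K (err_point X x i - err_point X x j) =
    err_weight a i * (K (err_point X x i - x) -
      \sum_j a j * K (err_point X x i - X j)).
  rewrite -(err_sum (fun y => K (err_point X x i - y))) mulr_sumr.
  by apply: eq_bigr => j _; rewrite mulrA.
under eq_bigr do rewrite row.
rewrite (err_sum (fun y => K (y - x) - \sum_j a j * K (y - X j))) subrr.
under [X in _ - X]eq_bigr do rewrite mulrBr.
rewrite sumrB.
have -> : \sum_i a i * K (X i - x) = \sum_j a j * K (x - X j).
  by apply: eq_bigr => j _; rewrite -Ksym opprB.
have -> : \sum_i a i * (\sum_j a j * K (X i - X j)) =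
    \sum_i \sum_j a i * a j * K (X i - X j).
  by apply: eq_bigr => i _; rewrite mulr_sumr; apply: eq_bigr => j _; rewrite mulrA.
by ring.
Qed.

(** The points are shifted by [x], which leaves their differences unchanged and
    makes the frequency integrand the error of approximating [1]. *)
Lemma err_form_integral K f X x a : spectral_density K f ->
  (\int[lebesgue_rV]_w
     (trig_square (err_weight a) (fun i => err_point X x i - x) w * f w)%:E =
   (err_form K X x a)%:E)%E.
Proof.
move=> sd; rewrite (spectral_quadratic_form _ _ sd); congr EFin.
apply: eq_bigr => i _; apply: eq_bigr => j _.
by rewrite opprB addrA subrK.
Qed.

Lemma err_form_le K1 K2 f1 f2 c X x a :
  spectral_density K1 f1 -> spectral_density K2 f2 ->
  0 <= c -> (forall w, 0 <= f1 w) -> (forall w, 0 <= f2 w) ->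
  (forall w, f1 w <= c * f2 w) ->
  err_form K1 X x a <= c * err_form K2 X x a.
Proof.
move=> sd1 sd2 c0 f10 f20 f12; rewrite -lee_fin EFinM.
rewrite -(err_form_integral _ _ _ sd1) -(err_form_integral _ _ _ sd2).
set g := trig_square _ _.
have mg : measurable_fun setT g by exact: measurable_trig_square.
have g0 w : 0 <= g w by exact: trig_square_ge0.
have mf K f : spectral_density K f -> measurable_fun setT f.
  by case=> fint _; apply/measurable_EFinP; case/integrableP: fint.
have mgf K f : spectral_density K f ->
    measurable_fun setT (fun w => (g w * f w)%:E).
  by move=> /mf mf'; apply/measurable_EFinP; exact: measurable_funM.
have mgf2 := mgf _ _ sd2.
rewrite -ge0_integralZl//; last first.
  by move=> w _; rewrite lee_fin mulr_ge0.
apply: ge0_le_integral => //.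
- by move=> w _; rewrite lee_fin mulr_ge0.
- exact: mgf sd1.
- exact: measurable_funeM.
- by move=> w _; rewrite -EFinM lee_fin mulrCA ler_wpM2l.
Qed.

Definition kriging_weight (Phi : 'rV[R]_d -> R) X x (j : 'I_n) : R :=
  ((\col_i Phi (x - X i) : 'cV[R]_n)^T *m
    invmx (\matrix_(i, k) Phi (X i - X k))) ord0 j.

Lemma krigingE Phi X z x :
  kriging Phi X z x = \sum_j kriging_weight Phi X x j * z (X j).
Proof.
by rewrite /kriging mxE; apply: eq_bigr => j _; rewrite [(\col__ _) _ _]mxE.
Qed.

Lemma kriging_weight_continuous Phi X j : continuous Phi ->
  continuous (fun x => kriging_weight Phi X x j).
Proof.
move=> cPhi; under eq_fun do rewrite /kriging_weight mxE.
move=> x; apply: (cvg_big (@add_continuous R) (nbhs_filter x)) => i _.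
under eq_fun do rewrite mxE mxE.
rewrite mxE mxE; apply: cvgM; last exact: cvg_cst.
apply: (cvg_comp (fun x => x - X i) Phi _ (cPhi _)).
exact: (cvgB cvg_id (cvg_cst _)).
Qed.

Lemma kernel_matrix_unit Phi X : injective X ->
  positive_definite_kernel (fun x y => Phi (x - y)) ->
  (\matrix_(i, k) Phi (X i - X k) : 'M[R]_n) \in unitmx.
Proof.
move=> injX pd; rewrite -row_free_unit; apply: inj_row_free => v vK.
apply/rowP => i; rewrite mxE; apply/eqP; apply: contraT => vi.
have := pd n X (fun i => v ord0 i) injX (ex_intro _ i vi).
rewrite exchange_big/= big1 ?ltxx// => k _.
have := congr1 (fun u : 'rV_n => u ord0 k) vK; rewrite /= !mxE => vKk.
transitivity (v ord0 k * \sum_j v ord0 j * Phi (X j - X k)).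
  by rewrite mulr_sumr; apply: eq_bigr => j _; rewrite mulrCA mulrA.
rewrite (_ : \sum_j _ = 0) ?mulr0//.
by rewrite -[RHS]vKk; apply: eq_bigr => j _; rewrite mxE.
Qed.

Lemma kriging_weight_eq Phi X x : injective X ->
  positive_definite_kernel (fun x y => Phi (x - y)) ->
  forall j, \sum_i kriging_weight Phi X x i * Phi (X i - X j) = Phi (x - X j).
Proof.
move=> injX pd j; have uK := kernel_matrix_unit injX pd.
have := congr1 (fun u : 'rV_n => u ord0 j)
  (mulmxKV uK (\col_i Phi (x - X i) : 'cV[R]_n)^T).
rewrite /= [in RHS]mxE [in RHS]mxE => <-; rewrite mxE.
by apply: eq_bigr => i _; congr (_ * _); rewrite mxE.
Qed.

(** The kriging weights minimise the error form of their own kernel, a convex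
    quadratic function of the weights whose gradient vanishes there. *)
Lemma kriging_weight_optimal Phi X x a : injective X ->
  positive_definite_kernel (fun x y => Phi (x - y)) ->
  (forall y, Phi (- y) = Phi y) ->
  err_form Phi X x (kriging_weight Phi X x) <= err_form Phi X x a.
Proof.
move=> injX pd Psym; rewrite !err_formE//.
set k := kriging_weight Phi X x; pose r j := Phi (x - X j).
have kr j : \sum_i k i * Phi (X i - X j) = r j by exact: kriging_weight_eq.
pose q (u v : 'I_n -> R) := \sum_i \sum_j u i * v j * Phi (X i - X j).
have qk u : q k u = \sum_j u j * r j.
  rewrite /q exchange_big/=; apply: eq_bigr => j _; rewrite -kr mulr_sumr.
  by apply: eq_bigr => i _; rewrite mulrCA mulrA.
have qC u v : q u v = q v u.
  rewrite /q exchange_big/=; apply: eq_bigr => j _; apply: eq_bigr => i _.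
  by rewrite -Psym opprB [u i * _]mulrC.
have qB : q (fun i => a i - k i) (fun i => a i - k i) =
    q a a - q a k - q k a + q k k.
  rewrite /q -!sumrB -big_split; apply: eq_bigr => i _ /=.
  by rewrite -!sumrB -big_split; apply: eq_bigr => j _ /=; ring.
have q0 : 0 <= q (fun i => a i - k i) (fun i => a i - k i).
  have [/forallP ak|] := boolP [forall i, a i - k i == 0].
    by apply: sumr_ge0 => i _; rewrite big1// => j _; rewrite (eqP (ak i)) !mul0r.
  by rewrite negb_forall => /existsP/(pd n X _ injX)/ltW.
move: q0; rewrite qB (qC a k) !qk -/(q a a) -/(q k k) qk.
rewrite -/(r _); under [X in _ - 2 * X + _ <= _]eq_bigr do rewrite -/(r _).
under [X in _ <= _ - 2 * X + _]eq_bigr do rewrite -/(r _).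
lra.
Qed.

End interpolation_error.

(** With the reproduction weights the error at frequency [w] has modulus at most
    a constant times [min 1 ((c h `|w|)^m)], and [decay_integral_le] integrates
    the square of this against the spectral density. *)
Lemma err_form_upper_bound (R : realType) d (Omega : set 'rV[R]_d)
    (Phi f : 'rV[R]_d -> R) (c4 nu : R) :
  compact Omega -> interior_cone_condition Omega -> 0 < c4 -> 0 < nu ->
  spectral_density Phi f ->
  (forall w, 0 <= f w <= c4 * (1 + enorm w ^+ 2) `^ (- (nu + d%:R / 2))) ->
  exists h0 C : R, [/\ 0 < h0, 0 < C &
    forall (n : nat) (X : 'I_n -> 'rV[R]_d), design Omega X ->
      0 < fill_distance X Omega <= h0 ->
      forall x, Omega x -> exists a : 'I_n -> R,
        err_form Phi X x a <= C * fill_distance X Omega `^ (2 * nu)].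
Proof.
move=> cO cone c40 nu0 sd fb.
pose m := (Num.truncn nu).+1.
have num : nu < m%:R by exact: truncnS_gt.
have [h0 [c [V [h00 cc0 V0 repr]]]] := local_polynomial_reproduction m cO cone.
have [|C C0 dec] := @decay_integral_le R d m nu; first by rewrite nu0.
pose D := c4 * (2 * (1 + V) ^+ 2).
have D0 : 0 < D by rewrite mulr_gt0// mulr_gt0// exprn_gt0// addr_gt0.
exists h0, (D * (C * c `^ (2 * nu))); split => //.
  by rewrite mulr_gt0// mulr_gt0// powR_gt0.
move=> n X DX hX x Ox; have [a [aV asup arep]] := repr n X DX hX x Ox.
exists a; case/andP: hX; set h := fill_distance X Omega => h_gt0 hh0.
have ch0 : 0 < c * h by rewrite mulr_gt0.
have mf : measurable_fun setT f.
  by case: sd => fint _; apply/measurable_EFinP; case/integrableP: fint.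
rewrite -lee_fin -(err_form_integral _ _ _ sd).
pose g w := Num.min 1 ((c * h * enorm (w : 'rV[R]_d)) ^+ m) ^+ 2 *
        (1 + enorm w ^+ 2) `^ (- (nu + d%:R / 2)).
apply: (@le_trans _ _ (\int[lebesgue_rV]_w (D%:E * (g w)%:E))%E); last first.
  rewrite ge0_integralZl//; first last.
  - by rewrite lee_fin ltW.
  - by move=> w _; rewrite lee_fin mulr_ge0 ?sqr_ge0 ?powR_ge0.
  - by apply/measurable_EFinP; exact: measurable_decay.
  rewrite -mulrA [leRHS]EFinM lee_pmul2l// ?lte_fin//.
  apply: le_trans (dec _ ch0) _.
  by rewrite lee_fin powRM ?(ltW cc0) ?(ltW h_gt0)// mulrA.
apply: ge0_le_integral => //.
- move=> w _; rewrite lee_fin mulr_ge0 ?trig_square_ge0//.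
  by case/andP: (fb w).
- apply/measurable_EFinP/measurable_funM => //.
  exact: measurable_trig_square.
- by apply: measurable_funeM; apply/measurable_EFinP; exact: measurable_decay.
move=> w _; rewrite -EFinM lee_fin.
have [fw0 fw] := andP (fb w).
apply: (@le_trans _ _
    (2 * (1 + V) ^+ 2 * Num.min 1 ((c * h * enorm w) ^+ m) ^+ 2 * f w)).
  rewrite ler_wpM2r//.
  have := @exp_sum_error R n m a (fun j => dotp w (X j - x)) V (c * h * enorm w).
  rewrite ger0_norm; last by rewrite mulr_ge0 ?enorm_ge0// ltW.
  rewrite /trig_square.
  rewrite (err_sum (fun y => cos (dotp w (y - x)))).
  rewrite (err_sum (fun y => sin (dotp w (y - x)))).
  rewrite subrr (_ : dotp w 0 = 0); last by apply: big1 => i _; rewrite mxE mulr0.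
  rewrite cos0 sin0 sub0r sqrrN; apply => //.
  - move=> j /asup Xj; apply: le_trans (cauchy_schwarz _ _) _.
    by rewrite mulrC ler_wpM2r ?enorm_ge0.
  - by move=> k km; exact: arep.
set M := Num.min _ _ ^+ 2; set W := 2 * (1 + V) ^+ 2.
have -> : D * g w = W * M * (c4 * (1 + enorm w ^+ 2) `^ (- (nu + d%:R / 2))).
  by rewrite /D /g -/M -/W; ring.
by rewrite ler_wpM2l// mulr_ge0 ?sqr_ge0// mulr_ge0// sqr_ge0.
Qed.

(** * Exponential moments of Gaussian variables *)

Section density.
Context d (T : measurableType d) (R : realType).
Variables (mu nu : {measure set T -> \bar R}) (f : T -> R).
Hypotheses (f0 : forall x, 0 <= f x) (mf : measurable_fun setT f).
Hypothesis nuE : forall A, measurable A ->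
  (nu A = \int[mu]_(x in A) (f x)%:E)%E.

Import HBNNSimple.

Let integral_density_nnsfun (h : {nnsfun T >-> R}) :
  (\int[nu]_x (h x)%:E = \int[mu]_x ((h x)%:E * (f x)%:E))%E.
Proof.
under [LHS]eq_integral do rewrite fimfunE -fsumEFin//.
rewrite [LHS]ge0_integral_fsum//; last 2 first.
  - by move=> r; exact/measurable_EFinP/measurableT_comp.
  - by move=> n x _; rewrite EFinM nnfun_muleindic_ge0.
under [RHS]eq_integral.
  move=> x xD; rewrite fimfunE -fsumEFin// muleC ge0_mule_fsumr; last first.
    by move=> r; rewrite EFinM nnfun_muleindic_ge0.
  over.
have mfE : measurable_fun setT (EFin \o f) by exact/measurable_EFinP.
rewrite [RHS]ge0_integral_fsum//; last 2 first.
  - move=> r; apply: emeasurable_funM => //.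
    by apply/measurable_EFinP; exact/measurableT_comp.
  - move=> n x _; apply: mule_ge0; first by rewrite lee_fin.
    by rewrite EFinM nnfun_muleindic_ge0.
apply: eq_fsbigr => r _.
rewrite integralZl_indic_nnsfun//= integral_indic//= setIT nuE//.
have [r0|r0] := ltP r 0.
  rewrite preimage_nnfun0// integral_set0 mule0 integral0_eq// => x _.
  by rewrite indicE in_set0 mulr0 mule0.
rewrite -ge0_integralZl//; last 2 first.
  - exact: measurable_funTS.
  - by move=> x _; rewrite lee_fin.
rewrite integral_mkcond; apply: eq_integral => x _.
rewrite patchE indicE; case: ifPn => _; first by rewrite mulr1 muleC.
by rewrite mulr0 mule0.
Qed.

Lemma ge0_integral_density (g : T -> \bar R) : measurable_fun setT g ->
  (forall x, 0 <= g x)%E -> (\int[nu]_x g x = \int[mu]_x (g x * (f x)%:E))%E.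
Proof.
move=> mg g0; pose g_ := nnsfun_approx measurableT mg.
transitivity (lim (\int[nu]_x (g_ n x)%:E @[n --> \oo])%E).
  rewrite -monotone_convergence//=.
  - apply: eq_integral => ? /[!inE] xD; apply/esym/cvg_lim => //=.
    exact: cvg_nnsfun_approx.
  - by move=> n; exact/measurable_EFinP/measurable_funTS.
  - by move=> n ? _; rewrite lee_fin.
  - by move=> ? _ ? ? mn; rewrite lee_fin; exact/lefP/nd_nnsfun_approx.
rewrite [RHS](_ : _ = lim
    (\int[mu]_x ((g_ n x)%:E * (f x)%:E) @[n --> \oo])%E); last first.
  rewrite -monotone_convergence//=.
  - apply: eq_integral => x /[!inE] xD; apply/esym/cvg_lim => //.
    apply: cvgeZr => //; exact: cvg_nnsfun_approx.
  - move=> n; apply: emeasurable_funM.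
      exact/measurable_EFinP/measurable_funTS.
    exact/measurable_EFinP.
  - by move=> n x _; rewrite mule_ge0 ?lee_fin.
  - move=> x _ ? ? mn; apply: lee_wpmul2r; rewrite lee_fin//.
    exact/lefP/nd_nnsfun_approx.
by apply: congr_lim; apply/funext => n /=; exact: integral_density_nnsfun.
Qed.

End density.

(** Completing the square in the exponent gives a multiple of the density with
    mean [m / D] and standard deviation [s / sqrt D], [D = 1 + 2 c s^2]. *)
Lemma integral_expR_sqr_normal_pdf (R : realType) (m s c : R) :
  0 < s -> 0 < 1 + 2 * c * s ^+ 2 ->
  (\int[lebesgue_measure]_x ((expR (- c * x ^+ 2))%:E * (normal_pdf m s x)%:E) =
   ((Num.sqrt (1 + 2 * c * s ^+ 2))^-1 *
     expR (- c * m ^+ 2 / (1 + 2 * c * s ^+ 2)))%:E)%E.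
Proof.
move=> s0; set D := 1 + 2 * c * s ^+ 2 => D0.
have sD0 : 0 < Num.sqrt D by rewrite sqrtr_gt0.
have sDD : Num.sqrt D ^+ 2 = D by rewrite sqr_sqrtr// ltW.
set K := _ * expR _.
have sn0 : s != 0 by rewrite gt_eqF.
have s'0 : s / Num.sqrt D != 0 by rewrite mulf_neq0// invr_eq0 gt_eqF.
transitivity (\int[lebesgue_measure]_x
    (K%:E * (normal_pdf (m / D) (s / Num.sqrt D) x)%:E))%E; last first.
  rewrite ge0_integralZl//.
  - by rewrite integral_normal_pdf mule1.
  - by apply/measurable_EFinP; exact: measurable_normal_pdf.
  - by move=> x _; rewrite lee_fin normal_pdf_ge0.
  - by rewrite lee_fin mulr_ge0 ?expR_ge0// invr_ge0 ltW.
apply: eq_integral => x _; rewrite -!EFinM; congr EFin.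
rewrite !normal_pdfE//= /normal_peak /normal_fun.
have -> : (s / Num.sqrt D) ^+ 2 * pi *+ 2 = s ^+ 2 * pi *+ 2 / D.
  by rewrite exprMn exprVn sDD mulrnAl; congr (_ *+ _); ring.
have p0 : 0 <= s ^+ 2 * pi *+ 2 by rewrite mulrn_wge0// mulr_ge0 ?sqr_ge0 ?pi_ge0.
rewrite (sqrtrM _ p0) sqrtrV ?(ltW D0)//.
set q := Num.sqrt (s ^+ 2 * pi *+ 2).
have q0 : q != 0.
  rewrite gt_eqF// sqrtr_gt0 pmulrn_lgt0// mulr_gt0 ?pi_gt0// exprn_gt0//.
rewrite /K mulrACA -expRD [in LHS]mulrCA -expRD.
congr (_ * expR _).
  by field; rewrite q0 gt_eqF.
rewrite exprMn exprVn sDD /D; field.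
by rewrite sn0 andbT gt_eqF.
Qed.

Section normal_moments.
Context dT (T : measurableType dT) (R : realType) (P : probability T R).
Variable X : T -> R.
Hypotheses (mX : measurable_fun setT X) (nX : normal_rv P X).

Lemma normal_rv_integral : exists m s : R, 0 <= s /\
  forall g : R -> R, measurable_fun setT g -> (forall x, 0 <= g x) ->
    (\int[P]_w (g (X w))%:E = if (s == 0)%R then (g m)%:E else
      \int[lebesgue_measure]_x ((g x)%:E * (normal_pdf m s x)%:E))%E.
Proof.
case: nX => m [s [s0 law]]; exists m, s; split=> // g mg g0.
have mX' : @measurable_fun _ _ T (measurableTypeR R) setT X by exact: mX.
pose X' : {RV P >-> measurableTypeR R} :=
  @mfun_Sub _ _ T (measurableTypeR R) X (mem_set mX').
have mgE : measurable_fun [set: measurableTypeR R] (EFin \o g).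
  by exact/measurable_EFinP.
rewrite -(@ge0_integral_distribution _ _ _ _ _ _ X' (EFin \o g))//.
case: ifPn => s00.
  rewrite (@eq_measure_integral _ (measurableTypeR R) R setT
    (\d_(m : measurableTypeR R))).
    by rewrite integral_dirac//= diracT mul1e.
  by move=> A mA _; have := law A mA; rewrite s00.
have := @ge0_integral_density _ _ R lebesgue_measure (distribution P X')
  (normal_pdf m s) _ _ _ (EFin \o g); apply => //.
- by move=> x; exact: normal_pdf_ge0.
- exact: measurable_normal_pdf.
- by move=> A mA; have := law A mA; rewrite (negbTE s00).
Qed.

(** Integrating [1 <= exp (- c x^2) + c x^2] with [c = 1 / (2 max(m^2, s^2))],
    where the first term has expectation at most [4/5], bounds the squares of
    both parameters by [5 v / 2].  With the exponent [1 / (20 v)] the expectation is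
    then at most [2] uniformly in the parameters. *)
Lemma normal_rv_exp_moment (v : R) : 0 < v ->
  (\int[P]_w (X w ^+ 2)%:E <= v%:E)%E ->
  (\int[P]_w (expR ((20 * v)^-1 * X w ^+ 2))%:E <= 2%:E)%E.
Proof.
move=> v0 Xv; have [m [s [s0 law]]] := normal_rv_integral.
have msqr : measurable_fun setT (fun x : R => x ^+ 2) by exact: measurable_funX.
have mexp (c : R) : measurable_fun setT (fun x : R => expR (c * x ^+ 2)).
  apply: (measurableT_comp (@measurable_expR R)).
  by apply: measurable_funM => //; exact: measurable_cst.
have e16 : expR (6^-1) <= 6 / 5 :> R.
  have := expR_ge1Dx (- 6^-1 : R); rewrite expRN => H.
  by rewrite -[leLHS]invrK invf_ple ?posrE ?invr_gt0 ?expR_gt0//; lra.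
rewrite (law (fun x => expR ((20 * v)^-1 * x ^+ 2)))//.
have := Xv; rewrite (law _ msqr (@sqr_ge0 R)).
case: ifPn => [_|sn0 Xv'].
  rewrite !lee_fin => mv; apply: le_trans (_ : expR (6^-1) <= _); last lra.
  rewrite ler_expR mulrC ler_pdivrMr ?mulr_gt0//; lra.
have sp : 0 < s by rewrite lt_neqAle eq_sym sn0.
pose M2 := Num.max (m ^+ 2) (s ^+ 2).
have M20 : 0 < M2 by rewrite lt_max orbC exprn_gt0.
have mM : m ^+ 2 <= M2 by rewrite le_max lexx.
have sM : s ^+ 2 <= M2 by rewrite le_max lexx orbT.
pose c := (2 * M2)^-1.
have c0 : 0 < c by rewrite invr_gt0 mulr_gt0.
have cM : c * M2 = 2^-1 by rewrite /c; field; rewrite gt_eqF.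
have M2v : M2 <= 5 / 2 * v.
  have mpdf : measurable_fun [set: measurableTypeR R]
      (fun x : R => (normal_pdf m s x)%:E).
    by apply/measurable_EFinP; exact: measurable_normal_pdf.
  have pdf0 x : (0 <= (normal_pdf m s x)%:E)%E by rewrite lee_fin normal_pdf_ge0.
  have m1 : measurable_fun [set: measurableTypeR R]
      (fun x : R => (expR (- c * x ^+ 2))%:E * (normal_pdf m s x)%:E)%E.
    by apply: emeasurable_funM => //; apply/measurable_EFinP; exact: mexp.
  have m2 : measurable_fun [set: measurableTypeR R]
      (fun x : R => (x ^+ 2)%:E * (normal_pdf m s x)%:E)%E.
    by apply: emeasurable_funM => //; exact/measurable_EFinP.
  have p1 x : (0 <= (expR (- c * x ^+ 2))%:E * (normal_pdf m s x)%:E)%E.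
    by rewrite mule_ge0// lee_fin expR_ge0.
  have p2 x : (0 <= (x ^+ 2)%:E * (normal_pdf m s x)%:E)%E.
    by rewrite mule_ge0// lee_fin sqr_ge0.
  have p2' x : (0 <= c%:E * ((x ^+ 2)%:E * (normal_pdf m s x)%:E))%E.
    by rewrite mule_ge0// lee_fin ltW.
  suff : (1%:E <= (4 / 5 + c * v)%:E)%E.
    rewrite lee_fin => cv; have : M2 * 5^-1 <= M2 * (c * v).
      by rewrite ler_pM2l//; lra.
    by rewrite mulrA [M2 * c]mulrC cM; lra.
  rewrite -(integral_normal_pdf m s).
  apply: (@le_trans _ _ (\int[lebesgue_measure]_x
     ((expR (- c * x ^+ 2))%:E * (normal_pdf m s x)%:E +
      c%:E * ((x ^+ 2)%:E * (normal_pdf m s x)%:E))))%E.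
    apply: ge0_le_integral => //.
    - by apply: emeasurable_funD => //; exact: measurable_funeM.
    move=> x _; rewrite muleA -ge0_muleDl ?lee_fin ?expR_ge0//; last first.
      by rewrite mulr_ge0 ?sqr_ge0// ltW.
    rewrite -[leLHS]mul1r ler_wpM2r ?normal_pdf_ge0// mulNr.
    by have := expR_ge1Dx (- (c * x ^+ 2)); lra.
  rewrite ge0_integralD//; last exact: measurable_funeM.
  rewrite ge0_integralZl//; last by rewrite lee_fin ltW.
  rewrite EFinD [(c * v)%:E]EFinM; apply: leeD; last by rewrite lee_pmul2l// lte_fin.
  have D1 : 1 <= 1 + 2 * c * s ^+ 2.
    by rewrite lerDl mulr_ge0 ?sqr_ge0// mulr_ge0// ltW.
  rewrite integral_expR_sqr_normal_pdf//; last by apply: lt_le_trans D1.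
  rewrite lee_fin; set D := 1 + _ in D1 *.
  have D0 : 0 < D by apply: lt_le_trans D1.
  have D2 : D <= 2.
    have : c * s ^+ 2 <= c * M2 by rewrite ler_pM2l.
    by rewrite cM /D; lra.
  have isD1 : (Num.sqrt D)^-1 <= 1.
    by rewrite invf_le1 ?sqrtr_gt0// -sqrtr1 ler_wsqrtr.
  have [ms|sm] := leP (m ^+ 2) (s ^+ 2).
    have DE : D = 2 by move: cM; rewrite /D /M2 max_r// => cM; lra.
    rewrite -[4 / 5]mulr1; apply: ler_pM; rewrite ?invr_ge0 ?sqrtr_ge0 ?expR_ge0//.
      have s54 : 5 / 4 <= Num.sqrt 2 :> R.
        rewrite -[leLHS]ger0_norm ?divr_ge0// -sqrtr_sqr ler_wsqrtr// expr2; lra.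
      by rewrite DE -(invf_div 5 4) lef_pV2// posrE; lra.
    rewrite expR_le1 mulNr mulNr oppr_le0 mulr_ge0 ?invr_ge0 ?(ltW D0)//.
    by rewrite mulr_ge0 ?sqr_ge0// ltW.
  rewrite -[4 / 5]mul1r; apply: ler_pM; rewrite ?invr_ge0 ?sqrtr_ge0 ?expR_ge0//.
  have e14 : expR (- 4^-1) <= 4 / 5 :> R.
    have := expR_ge1Dx (4^-1 : R); rewrite expRN => H.
    by rewrite invf_ple ?posrE ?invr_gt0 ?expR_gt0//; lra.
  apply: le_trans e14; rewrite ler_expR mulNr mulNr lerN2 ler_pdivlMr//.
  have -> : c * m ^+ 2 = 2^-1 by rewrite -cM /M2 max_l// ltW.
  by lra.
have th0 : 0 < (20 * v)^-1 by rewrite invr_gt0 mulr_gt0.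
have thM : (20 * v)^-1 * M2 <= 8^-1.
  by rewrite mulrC ler_pdivrMr ?mulr_gt0//; lra.
set th := (20 * v)^-1 in th0 thM *.
have ths : th * s ^+ 2 <= 8^-1 by apply: le_trans thM; rewrite ler_pM2l.
have thm : th * m ^+ 2 <= 8^-1 by apply: le_trans thM; rewrite ler_pM2l.
have := @integral_expR_sqr_normal_pdf R m s (- th) sp.
rewrite opprK => ->; last by lra.
rewrite lee_fin; set D := 1 + _.
have D34 : 3 / 4 <= D by rewrite /D; lra.
have sD : 3 / 4 <= Num.sqrt D.
  rewrite -[leLHS]ger0_norm ?divr_ge0// -sqrtr_sqr ler_wsqrtr//.
  by apply: le_trans D34; rewrite expr2; lra.
have iD : (Num.sqrt D)^-1 <= 4 / 3.
  by rewrite -(invf_div 3 4) lef_pV2// posrE; lra.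
apply: (@le_trans _ _ (4 / 3 * (6 / 5))); last by lra.
apply: ler_pM; rewrite ?invr_ge0 ?sqrtr_ge0 ?expR_ge0//.
by apply: le_trans e16; rewrite ler_expR ler_pdivrMr; lra.
Qed.

End normal_moments.

(** * From pointwise variance to the [L_p] norm *)

(** Beyond [mu] the function [exp (theta y^2) / `|y|^p] increases, because
    [p / 2 <= theta mu^2]. *)
Lemma powR_le_exp_sqr (R : realType) (p theta mu y : R) : 1 <= p -> 0 < mu ->
  p / 2 <= theta * mu ^+ 2 ->
  `|y| `^ p <= mu `^ p + mu `^ p * expR (- (theta * mu ^+ 2)) *
                          expR (theta * y ^+ 2).
Proof.
move=> p1 mu0 pth; have p0 : 0 <= p by apply: le_trans p1.
have m0 : 0 < mu `^ p by rewrite powR_gt0.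
have [ymu|muy] := leP `|y| mu.
  apply: (@le_trans _ _ (mu `^ p)).
    by rewrite ge0_ler_powR// nnegrE ltW.
  by rewrite lerDl !mulr_ge0 ?expR_ge0// ltW.
apply: (@le_trans _ _ (mu `^ p * expR (- (theta * mu ^+ 2)) * expR (theta * y ^+ 2)));
  last by rewrite lerDr ltW.
have y0 : 0 < `|y| by apply: lt_trans muy.
have -> : `|y| = mu * (`|y| / mu) by rewrite mulrCA divff ?mulr1// gt_eqF.
have s0 : 0 < `|y| / mu by rewrite divr_gt0.
rewrite powRM ?(ltW mu0) ?(ltW s0)// -mulrA ler_pM2l// -expRD.
rewrite /powR gt_eqF// ler_expR.
set s := (`|y| / mu) ^+ 2.
have s1 : 1 <= s.
  by rewrite /s exprn_ege1// ler_pdivlMr// mul1r ltW.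
have -> : p * ln (`|y| / mu) = p / 2 * ln s.
  by rewrite /s lnXn// mulr2n; field.
have -> : - (theta * mu ^+ 2) + theta * y ^+ 2 = theta * mu ^+ 2 * (s - 1).
  rewrite /s exprMn exprVn real_normK ?num_real//; field.
  by rewrite gt_eqF.
have lns : ln s <= s - 1.
  by rewrite -ler_expR lnK ?posrE ?(lt_le_trans _ s1)//;
    apply: le_trans (expR_ge1Dx _); rewrite addrC subrK.
apply: (@le_trans _ _ (p / 2 * (s - 1))).
  by rewrite ler_wpM2l// divr_ge0.
by rewrite ler_wpM2r// subr_ge0.
Qed.

(** Tonelli bounds the expectation of [int_Omega exp (theta G^2)] by [2 V]; by
    the Markov inequality this integral is below [V exp (theta mu^2)] with the
    stated probability, and then [powR_le_exp_sqr] bounds the integral of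
    [`|G|^p]. *)
Lemma integral_powR_tail (R : realType) d dT (T : measurableType dT)
    (P : probability T R) (Omega : set 'rV[R]_d) (V p theta mu : R)
    (G : 'rV[R]_d * T -> R) :
  measurable Omega -> 0 < V -> (lebesgue_rV Omega <= V%:E)%E ->
  measurable_fun setT G -> 1 <= p -> 0 < mu -> p / 2 <= theta * mu ^+ 2 ->
  (forall x, Omega x ->
     (\int[P]_w (expR (theta * G (x, w) ^+ 2))%:E <= 2%:E)%E) ->
  exists A : set T, [/\ measurable A,
    ((1 - 2 * expR (- (theta * mu ^+ 2)))%:E <= P A)%E &
    forall w, A w ->
      (\int[lebesgue_rV]_(x in Omega) (`|G (x, w)| `^ p)%:E <=
       (2 * V * mu `^ p)%:E)%E].
Proof.
move=> mO V0 OV mG p1 mu0 pth EG.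
pose F (z : 'rV[R]_d * T) : \bar R :=
  ((\1_Omega z.1)%:E * (expR (theta * G z ^+ 2))%:E)%E.
have mexp : measurable_fun setT (fun z => expR (theta * G z ^+ 2)).
  apply: (measurableT_comp (@measurable_expR R)).
  by apply: measurable_funM; [exact: measurable_cst|exact: measurable_funX].
have mind : measurable_fun setT (fun z : 'rV[R]_d * T => \1_Omega z.1 : R).
  apply: (@measurableT_comp _ _ _ _ _ _ (\1_Omega : _ -> R) _ (@fst _ T)) => //.
have mF : measurable_fun setT F.
  by apply: emeasurable_funM; exact/measurable_EFinP.
have F0 z : (0 <= F z)%E.
  by rewrite mule_ge0 ?lee_fin ?expR_ge0.
pose H w := (\int[lebesgue_rV]_x F (x, w))%E.
have mH : measurable_fun setT H.
  exact: (@measurable_fun_fubini_tonelli_G _ _ _ _ _ lebesgue_rV F mF F0).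
have H0 w : (0 <= H w)%E by exact: integral_ge0.
have HE w : H w = (\int[lebesgue_rV]_(x in Omega) (expR (theta * G (x, w) ^+ 2))%:E)%E.
  rewrite [RHS]integral_mkcond; apply: eq_integral => x _.
  rewrite /F patchE indicE /=; case: ifPn => _; first by rewrite mul1e.
  by rewrite mul0e.
have EH : (\int[P]_w H w <= (2 * V)%:E)%E.
  rewrite -(@fubini_tonelli _ _ _ _ _ lebesgue_rV P F mF F0).
  apply: (@le_trans _ _ (\int[lebesgue_rV]_x (2%:E * (\1_Omega x)%:E))%E).
    apply: ge0_le_integral => //.
    - by move=> x _; exact: integral_ge0.
    - exact: (@measurable_fun_fubini_tonelli_F _ _ _ _ _ P F mF F0).
    - apply: emeasurable_funM; first exact: measurable_cst.
      by apply/measurable_EFinP; exact: measurable_indic.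
    move=> x _; have mx : measurable_fun setT
        (fun w => (expR (theta * G (x, w) ^+ 2))%:E).
      by apply/measurable_EFinP; exact: (measurable_fun_pair2 x mexp).
    have x0 w : (0 <= (expR (theta * G (x, w) ^+ 2))%:E)%E.
      by rewrite lee_fin expR_ge0.
    rewrite /F /= ge0_integralZl//.
    rewrite indicE; case: (boolP (x \in Omega)) => [/set_mem Ox|_].
      by rewrite mul1e mule1; exact: EG.
    by rewrite mul0e mule0.
  rewrite ge0_integralZl//; last exact/measurable_EFinP.
  rewrite integral_indic// setIT EFinM.
  by apply: lee_wpmul2l; rewrite ?lee_fin.
pose L := V * expR (theta * mu ^+ 2).
have L0 : 0 < L by rewrite mulr_gt0 ?expR_gt0.
pose B := [set w | (L%:E <= H w)%E].
have mB : measurable B.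
  rewrite -[X in measurable X]setTI; exact: emeasurable_fun_c_infty.
have PB : (P B <= (2 * expR (- (theta * mu ^+ 2)))%:E)%E.
  have : (L%:E * P B <= (2 * V)%:E)%E.
    apply: le_trans EH; rewrite -integral_cst//.
    apply: (@le_trans _ _ (\int[P]_(w in B) H w)%E).
      apply: ge0_le_integral => //; last exact: measurable_funTS.
      by move=> w _; rewrite lee_fin ltW.
    by apply: ge0_subset_integral.
  rewrite muleC -lee_pdivlMr// => /le_trans; apply.
  rewrite lee_fin expRN /L le_eqVlt; apply/orP; left; apply/eqP.
  by field; rewrite !gt_eqF ?expR_gt0.
exists (~` B); split; first exact: measurableC.
  rewrite probability_setC// EFinB leeB//.
move=> w /= wB.
have Hw : (H w <= L%:E)%E by rewrite leNgt; apply/negP => /ltW.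
have mGw : measurable_fun setT (fun x => G (x, w)).
  by exact: (measurable_fun_pair1 w mG).
have mexpw : measurable_fun setT (fun x => (expR (theta * G (x, w) ^+ 2))%:E).
  by apply/measurable_EFinP; exact: (measurable_fun_pair1 w mexp).
set K := mu `^ p * expR (- (theta * mu ^+ 2)).
have K0 : 0 <= K by rewrite mulr_ge0 ?powR_ge0 ?expR_ge0.
apply: (@le_trans _ _ (\int[lebesgue_rV]_(x in Omega)
   ((mu `^ p)%:E + K%:E * (expR (theta * G (x, w) ^+ 2))%:E))%E).
  apply: ge0_le_integral => //.
  - apply: measurable_funTS; apply/measurable_EFinP.
    apply: (measurableT_comp (measurable_powR p)).
    exact: (measurableT_comp (@normr_measurable _ _) mGw).
  - by apply: measurable_funTS; apply: emeasurable_funD => //; exact: measurable_funeM.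
  - by move=> x _; rewrite -EFinM -EFinD lee_fin; exact: powR_le_exp_sqr.
rewrite ge0_integralD//; first last.
- by apply: measurable_funTS; exact: measurable_funeM.
- by move=> x _; rewrite mule_ge0 ?lee_fin ?expR_ge0.
- by move=> x _; rewrite lee_fin powR_ge0.
rewrite integral_cst// ge0_integralZl//; last exact: measurable_funTS.
rewrite -HE; apply: (@le_trans _ _ ((mu `^ p)%:E * V%:E + K%:E * L%:E)%E).
  by apply: leeD; apply: lee_wpmul2l; rewrite ?lee_fin ?powR_ge0.
rewrite -!EFinM -EFinD lee_fin /K /L expRN le_eqVlt; apply/orP; left; apply/eqP.
by field; rewrite gt_eqF ?expR_gt0.
Qed.

Lemma Lp_norm_le (R : realType) d (p u : R) (Omega : set 'rV[R]_d)
    (g : 'rV[R]_d -> R) : 0 < p -> 0 <= u ->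
  (\int[lebesgue_rV]_(x in Omega) (`|g x| `^ p)%:E <= (u `^ p)%:E)%E ->
  (Lp_norm p Omega g <= u%:E)%E.
Proof.
move=> p0 u0 gu; rewrite /Lp_norm unlock.
have -> : u%:E = ((u `^ p)%:E `^ p^-1)%E.
  by rewrite poweR_EFin -powRrM divff ?gt_eqF// powRr1.
have -> : (\int[lebesgue_rV]_x `|((EFin \o g) \_ Omega) x| `^ p =
    \int[lebesgue_rV]_(x in Omega) (`|g x| `^ p)%:E)%E.
  rewrite [RHS]integral_mkcond; apply: eq_integral => x _.
  rewrite !patchE; case: ifPn => _ //=.
  by rewrite ?normr0 ?poweR_EFin powR0// gt_eqF.
apply: gt0_ler_poweR => //.
- by rewrite invr_ge0 ltW.
- by rewrite in_itv/= leey andbT integral_ge0// => x _; rewrite lee_fin powR_ge0.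
- by rewrite in_itv/= lee_fin powR_ge0 leey.
Qed.

Lemma second_moment_combination (R : realType) d dT (T : measurableType dT)
    (P : probability T R) (sigma : R) (Psi : 'rV[R]_d -> R)
    (Z : 'rV[R]_d -> {RV P >-> R}) n (b : 'I_n -> R) (z : 'I_n -> 'rV[R]_d) :
  (forall x, ('E_P[Z x] = 0)%E) ->
  (forall x x', covariance P (Z x) (Z x') = (sigma ^+ 2 * Psi (x - x'))%:E) ->
  (\int[P]_w ((\sum_i b i * Z (z i) w) ^+ 2)%:E =
   (sigma ^+ 2 * \sum_i \sum_j b i * b j * Psi (z i - z j))%:E)%E.
Proof.
move=> EZ covZ.
have EZZ x x' : (\int[P]_w (Z x w * Z x' w)%:E = (sigma ^+ 2 * Psi (x - x'))%:E)%E.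
  rewrite -covZ covariance.unlock !EZ expectation.unlock /=.
  apply: eq_integral => w _ /=.
  by transitivity ((Z x w - 0) * (Z x' w - 0))%:E; first rewrite !subr0.
have mZZ x x' : measurable_fun setT (fun w => (Z x w * Z x' w)%:E).
  by apply/measurable_EFinP; exact: measurable_funM.
have intsq x : P.-integrable setT (fun w => (Z x w * Z x w)%:E).
  apply/integrableP; split=> //.
  under eq_integral do rewrite gee0_abs ?lee_fin -?expr2 ?sqr_ge0// expr2.
  by rewrite EZZ ltry.
have intZ x x' : P.-integrable setT (fun w => (Z x w * Z x' w)%:E).
  apply: le_integrable (integrableD measurableT (intsq x) (intsq x')) => //.
  move=> w _; rewrite -EFinD !abse_EFin lee_fin.
  rewrite [leRHS]ger0_norm; last by rewrite addr_ge0// -expr2 sqr_ge0.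
  by rewrite ler_norml; apply/andP; split; nra.
pose g i j w := ((b i * b j)%:E * (Z (z i) w * Z (z j) w)%:E)%E.
have gint i j : P.-integrable setT (g i j) by exact: integrableZl.
transitivity (\int[P]_w \sum_i \sum_j g i j w)%E.
  apply: eq_integral => w _.
  transitivity (\sum_i \sum_j (b i * b j * (Z (z i) w * Z (z j) w)))%:E.
    congr EFin; rewrite expr2 mulr_suml; apply: eq_bigr => i _ /=.
    by rewrite mulr_sumr; apply: eq_bigr => j _ /=; rewrite mulrACA.
  by rewrite -sumEFin; apply: eq_bigr => i _; rewrite -sumEFin.
rewrite integral_sum//; last by move=> i; exact: integrable_sum.
rewrite mulr_sumr -sumEFin; apply: eq_bigr => i _.
rewrite integral_sum// mulr_sumr -sumEFin; apply: eq_bigr => j _.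
by rewrite /g integralZl// EZZ -EFinM; congr EFin; ring.
Qed.

(** * The error process *)

Section error_process.
Context (R : realType) (d : nat) (dT : measure_display) (T : measurableType dT)
  (P : probability T R) (Z : 'rV[R]_d -> {RV P >-> R}).
Variables (n : nat) (X : 'I_n -> 'rV[R]_d) (Phi : 'rV[R]_d -> R).

Definition kriging_error (z : 'rV[R]_d * T) : R :=
  Z z.1 z.2 - kriging Phi X (fun y => Z y z.2) z.1.

Lemma kriging_errorE x w : kriging_error (x, w) =
  \sum_i err_weight (kriging_weight Phi X x) i * Z (err_point X x i) w.
Proof.
by rewrite /kriging_error krigingE (err_sum (fun y => Z y w)).
Qed.

Lemma measurable_kriging_error x :
  measurable_fun setT (fun w => kriging_error (x, w)).
Proof.
under eq_fun do rewrite kriging_errorE.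
apply: measurable_sum => i.
by apply: measurable_funM; [exact: measurable_cst|exact: measurable_funP].
Qed.

(** Killing the error on a null set that contains all discontinuous paths makes
    it jointly measurable. *)
Lemma measurable_kriging_error_off (N : set T) : continuous Phi ->
  measurable N ->
  (forall w, ~ N w -> continuous (fun x : 'rV[R]_d => Z x w)) ->
  measurable_fun setT
    (fun z : 'rV[R]_d * T => kriging_error z * \1_(~` N) z.2).
Proof.
move=> cPhi mN cZ; apply: caratheodory_measurable => [w|x] /=; last first.
  apply: measurable_funM; first exact: measurable_kriging_error.
  by apply: measurable_indic; exact: measurableC.
have [Nw|Nw] := pselect (N w).
  have -> : (fun x => kriging_error (x, w) * \1_(~` N) w) = cst 0.
    by apply/funext => x; rewrite indicE memNset ?mulr0.
  exact: cst_continuous.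
suff cK : continuous (fun x => kriging_error (x, w)).
  move=> x; apply: (cvgM (FF := nbhs_filter x) (cK x)).
  exact: (@cvg_cst _ _ _ _ (nbhs_filter x)).
rewrite /kriging_error /=; under eq_fun do rewrite krigingE.
have csum : continuous (fun x : 'rV[R]_d =>
    \sum_j kriging_weight Phi X x j * Z (X j) w).
  move=> x; apply: (cvg_big (@add_continuous R) (nbhs_filter x)) => j _.
  apply: (cvgM (FF := nbhs_filter x)); first exact: kriging_weight_continuous.
  exact: (@cvg_cst _ _ _ _ (nbhs_filter x)).
by move=> x; exact: (cvgB (FF := nbhs_filter x) (cZ w Nw x) (csum x)).
Qed.

Lemma kriging_error_exp_moment (Psi : 'rV[R]_d -> R) (sigma v : R) x :
  gaussian_process Z -> (forall x, ('E_P[Z x] = 0)%E) ->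
  (forall x x', covariance P (Z x) (Z x') = (sigma ^+ 2 * Psi (x - x'))%:E) ->
  0 < v ->
  sigma ^+ 2 * err_form Psi X x (kriging_weight Phi X x) <= v ->
  (\int[P]_w (expR ((20 * v)^-1 * kriging_error (x, w) ^+ 2))%:E <= 2%:E)%E.
Proof.
move=> gZ EZ covZ v0 ev; apply: normal_rv_exp_moment => //.
- exact: measurable_kriging_error.
- have := gZ _ (err_point X x) (err_weight (kriging_weight Phi X x)).
  by rewrite -(funext (kriging_errorE x)).
- under eq_integral do rewrite kriging_errorE.
  by rewrite (second_moment_combination _ _ EZ covZ) lee_fin.
Qed.

End error_process.

(** * The probabilistic error bound *)

Theorem theorem3p4 (R : realType) (d : nat) (d_gt0 : (0 < d)%N)
    (Omega : set 'rV[R]_d)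
    (Omega_compact : compact Omega)
    (Omega_lipschitz : lipschitz_boundary Omega)
    (Omega_cone : interior_cone_condition Omega)
    (Psi Phi fPsi fPhi : 'rV[R]_d -> R)
    (Psi_corr : correlation_function Psi)
    (Phi_corr : correlation_function Phi)
    (fPsi_density : spectral_density Psi fPsi)
    (fPhi_density : spectral_density Phi fPhi)
    (c1 c2 c3 c4 nu0 nu : R)
    (c1_gt0 : 0 < c1) (c12 : c1 <= c2) (c3_gt0 : 0 < c3) (c34 : c3 <= c4)
    (nu0_gt0 : 0 < nu0) (nu_gt0 : 0 < nu)
    (fPsi_bounds : forall w : 'rV[R]_d,
      c1 * (1 + enorm w ^+ 2) `^ (- (nu0 + d%:R / 2)) <= fPsi w <=
      c2 * (1 + enorm w ^+ 2) `^ (- (nu0 + d%:R / 2)))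
    (fPhi_bounds : forall w : 'rV[R]_d,
      c3 * (1 + enorm w ^+ 2) `^ (- (nu + d%:R / 2)) <= fPhi w <=
      c4 * (1 + enorm w ^+ 2) `^ (- (nu + d%:R / 2)))
    (p : R) (p_ge1 : 1 <= p) (nu_le_nu0 : nu <= nu0) :
  exists C1 C2 h0 : R, [/\ 0 < C1, 0 < C2, 0 < h0 <= 1 &
    forall (dT : measure_display) (T : measurableType dT)
      (P : probability T R) (sigma : R) (Z : 'rV[R]_d -> {RV P >-> R}),
      0 < sigma ->
      gaussian_process Z ->
      {ae P, forall w, continuous (fun x : 'rV[R]_d => Z x w)} ->
      (forall x, ('E_P[Z x] = 0)%E) ->
      (forall x x', covariance P (Z x) (Z x') =
                    (sigma ^+ 2 * Psi (x - x'))%:E) ->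
    forall (n : nat) (X : 'I_n -> 'rV[R]_d) (t : R),
      design Omega X -> fill_distance X Omega <= h0 -> 0 < t ->
      with_probability_at_least P
        (1 - expR (- (t ^+ 2 /
               (C1 * sigma ^+ 2 * fill_distance X Omega `^ (2 * nu)))))
        [set w | (Lp_norm p Omega
                    (fun x => Z x w - kriging Phi X (fun y => Z y w) x)%R
                  <= (C2 * sigma * fill_distance X Omega `^ nu + t)%:E)%E]].
Proof.
have [cPhi _ Phisym Phipd _] := Phi_corr.
have c20 : 0 < c2 by exact: lt_le_trans c12.
have c40 : 0 < c4 by exact: lt_le_trans c34.
have base1 (w : 'rV[R]_d) : 1 <= 1 + enorm w ^+ 2 by rewrite lerDl sqr_ge0.
have fPhi0 w : 0 <= fPhi w.
  by case/andP: (fPhi_bounds w) => + _; apply: le_trans;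
    rewrite mulr_ge0 ?powR_ge0// ltW.
have fPsi0 w : 0 <= fPsi w.
  by case/andP: (fPsi_bounds w) => + _; apply: le_trans;
    rewrite mulr_ge0 ?powR_ge0// ltW.
have fPsiPhi w : fPsi w <= c2 / c3 * fPhi w.
  case/andP: (fPsi_bounds w) => _ /le_trans; apply.
  rewrite -mulrA ler_pM2l//.
  case/andP: (fPhi_bounds w) => Hlo _; rewrite [leRHS]mulrC ler_pdivlMr//.
  apply: le_trans Hlo; rewrite [leLHS]mulrC ler_pM2l// ler_powR//.
  by rewrite lerN2 lerD2r.
have [|h0 [C [h00 C0 HC]]] :=
  @err_form_upper_bound R d Omega Phi fPhi c4 nu Omega_compact Omega_cone
    c40 nu_gt0 fPhi_density.
  by move=> w; rewrite fPhi0/=; case/andP: (fPhi_bounds w).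
pose C' := c2 / c3 * C.
have C'0 : 0 < C' by rewrite mulr_gt0// divr_gt0.
pose V := fine (lebesgue_rV Omega) + 1.
have mOmega : measurable Omega by exact: compact_measurable_rV.
have V0 : 0 < V by rewrite ltr_wpDl// fine_ge0.
have OV : (lebesgue_rV Omega <= V%:E)%E.
  rewrite /V EFinD fineK ?leeDl// ge0_fin_numE//.
  exact: compact_lebesgue_rV_lty.
have p0 : 0 < p by apply: lt_le_trans p_ge1.
pose B := (2 * V) `^ p^-1.
have B0 : 0 < B by rewrite powR_gt0// mulr_gt0.
(* since B^p = 2 V, the bound 2 V mu^p on the integral is the bound B mu on the norm *)
pose C1 := 20 * B ^+ 2 * C'.
have C10 : 0 < C1 by rewrite mulr_gt0// mulr_gt0// exprn_gt0.
exists C1, (Num.sqrt (C1 * p)), (Num.min 1 h0); split => //.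
- by rewrite sqrtr_gt0 mulr_gt0.
- by rewrite lt_min ltr01 h00/= ge_min lexx.
move=> dT T P sigma Z sigma0 gZ cZ EZ covZ n X t DX hX t0.
set h := fill_distance X Omega in hX *.
have [n0 injX OX] := DX.
have h_ge0 : 0 <= h.
  have [j] := fill_distanceP Omega_compact DX (OX (Ordinal n0)).
  exact/le_trans/enorm_ge0.
have [h_eq0|h_neq0] := eqVneq h 0.
  (* the claimed probability is 1 - exp (- t^2 / 0) = 0 *)
  exists set0; split => //; rewrite h_eq0 powR0 ?mulf_neq0 ?gt_eqF//.
  by rewrite mulr0 invr0 mulr0 oppr0 expR0 subrr.
have h_gt0 : 0 < h by rewrite lt_neqAle eq_sym h_neq0.
have hh0 : 0 < h <= h0.
  by rewrite h_gt0/= (le_trans hX)// ge_min lexx orbT.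
pose v := C' * sigma ^+ 2 * h `^ (2 * nu).
have v0 : 0 < v by rewrite mulr_gt0 ?powR_gt0// mulr_gt0// exprn_gt0.
have errv x : Omega x ->
    sigma ^+ 2 * err_form Psi X x (kriging_weight Phi X x) <= v.
  move=> Ox; have [a ha] := HC n X DX hh0 x Ox.
  have -> : v = sigma ^+ 2 * (C' * h `^ (2 * nu)) by rewrite /v; ring.
  rewrite ler_pM2l ?exprn_gt0//.
  apply: le_trans (err_form_le _ _ _ fPsi_density fPhi_density _ fPsi0 fPhi0 fPsiPhi) _.
    by rewrite divr_ge0 ?ltW.
  rewrite /C' -mulrA ler_pM2l ?divr_gt0//.
  exact: le_trans (kriging_weight_optimal _ _ injX Phipd Phisym) ha.
have [N [mN PN0 cN]] := cZ.
have {}cN w : ~ N w -> continuous (fun x : 'rV[R]_d => Z x w).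
  by move=> Nw; apply: contrapT => /cN.
pose G (z : 'rV[R]_d * T) := kriging_error Z X Phi z * \1_(~` N) z.2.
have mG : measurable_fun setT G by exact: measurable_kriging_error_off.
pose u := Num.sqrt (C1 * p) * sigma * h `^ nu + t.
have u0 : 0 < u.
  by rewrite ltr_wpDl// mulr_ge0 ?powR_ge0// mulr_ge0 ?sqrtr_ge0// ltW.
pose theta := (20 * v)^-1.
have theta0 : 0 < theta by rewrite invr_gt0 mulr_gt0.
pose E := t ^+ 2 / (C1 * sigma ^+ 2 * h `^ (2 * nu)).
have hnu : h `^ (2 * nu) = (h `^ nu) ^+ 2.
  by rewrite mulrC powRrM powR_mulrn ?powR_ge0.
have hnu0 : 0 < h `^ nu by rewrite powR_gt0.
(* C2^2 = C1 p makes the exponent exceed the required E by p, which supplies the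
   threshold p / 2 of the tail bound and absorbs its factor 2 since 2 <= exp p *)
have tuE : p + E <= theta * (u / B) ^+ 2.
  have -> : theta * (u / B) ^+ 2 = u ^+ 2 / (C1 * sigma ^+ 2 * h `^ (2 * nu)).
    rewrite /theta /v /C1; field.
    by rewrite hnu expf_neq0 ?(gt_eqF hnu0) ?(gt_eqF sigma0) ?(gt_eqF C'0) ?(gt_eqF B0).
  have den0 : 0 < C1 * sigma ^+ 2 * h `^ (2 * nu).
    by rewrite mulr_gt0 ?powR_gt0// mulr_gt0// exprn_gt0.
  rewrite -lerBrDr /E -mulrBl ler_pdivlMr//.
  rewrite /u; set q := Num.sqrt _.
  have -> : p * (C1 * sigma ^+ 2 * h `^ (2 * nu)) = (q * sigma * h `^ nu) ^+ 2.
    have C1p : 0 <= C1 * p by rewrite mulr_ge0 ?ltW.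
    by rewrite !exprMn /q (sqr_sqrtr C1p) hnu; ring.
  have q0 : 0 <= q * sigma * h `^ nu.
    by rewrite mulr_ge0 ?powR_ge0// mulr_ge0 ?sqrtr_ge0// ltW.
  by nra.
have E0 : 0 <= E.
  by rewrite divr_ge0 ?sqr_ge0// mulr_ge0 ?powR_ge0// mulr_ge0 ?sqr_ge0// ltW.
have pth : p / 2 <= theta * (u / B) ^+ 2.
  by apply: le_trans tuE; lra.
have uB0 : 0 < u / B by rewrite divr_gt0.
have [x Ox|A [mA PA HA]] := integral_powR_tail (P := P) mOmega V0 OV mG p_ge1 uB0 pth.
  apply: le_trans (kriging_error_exp_moment gZ EZ covZ v0 (errv x Ox)).
  have mexp (F : T -> R) : measurable_fun setT F ->
      measurable_fun setT (fun w => (expR (theta * F w ^+ 2))%:E).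
    move=> mF; apply/measurable_EFinP; apply: (measurableT_comp (@measurable_expR R)).
    by apply: measurable_funM; [exact: measurable_cst|exact: measurable_funX].
  apply: ge0_le_integral => //.
  - by apply: mexp; exact: (measurable_fun_pair2 x mG).
  - by apply: mexp; exact: measurable_kriging_error.
  by move=> w _; rewrite lee_fin ler_expR ler_pM2l// /G exprMn ler_piMr ?sqr_ge0//.
exists (A `&` ~` N); split.
- by apply: measurableI => //; exact: measurableC.
- move=> w [Aw Nw] /=; apply: Lp_norm_le => //; first exact: ltW.
  have -> : u `^ p = 2 * V * (u / B) `^ p.
    rewrite powRM ?invr_ge0 ?(ltW u0) ?(ltW B0)//.
    rewrite -(powR_inv1 (ltW B0)) -powRrM mulN1r powRN /B -powRrM mulVf ?gt_eqF//.
    rewrite powRr1 ?mulr_ge0 ?(ltW V0)//; field.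
    by rewrite gt_eqF.
  apply: le_trans (HA w Aw); rewrite le_eqVlt; apply/orP; left; apply/eqP.
  by apply: eq_integral => x _; rewrite /G indicE mem_set ?mulr1.
- have PAN : P (A `&` N) = 0%E.
    apply/eqP; rewrite -measure_le0 -PN0; apply: le_measure; rewrite ?inE//.
    exact: measurableI.
  have <- : P A = P (A `&` ~` N).
    by rewrite -setDE -[RHS]adde0 -PAN; exact: measureDI.
  apply: le_trans PA; rewrite lee_fin lerD2l lerN2.
  apply: (@le_trans _ _ (2 * expR (- (p + E)))).
    by rewrite ler_pM2l// ler_expR lerN2.
  rewrite opprD expRD mulrA ler_piMl ?expR_ge0//.
  have := expR_ge1Dx p => ep.
  by rewrite expRN ler_pdivrMr ?expR_gt0// mul1r; lra.
Qed.
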